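(* Let $d \ge 2$, let $\mathcal{P} \subset \mathbb{R}^d$ be a $d$-dimensional polytope, let $H \subset \mathbb{R}^d$ be a $2$-dimensional real linear subspace that is not orthogonal to any edge of $\mathcal{P}$, and fix an orthonormal basis $\{e, f\} \subset \mathbb{R}^d$ of $H$. Then for every $\alpha \in \mathbb{C} \setminus \{0\}$, the null set $N(\mathcal{P})$ does not contain the ''circle'' $$C_\alpha := \big\{ \alpha (\cos t)\, e + \alpha (\sin t)\, f \in \mathbb{C}^d \;\big|\; t \in [-\pi, \pi] \big\},$$ that is, $C_\alpha \not\subset N(\mathcal{P})$.
   Context: A polytope is a convex polytope, i.e. the convex hull of finitely many points of $\mathbb{R}^d$; it is $d$-dimensional if it has nonempty interior. For $x, z \in \mathbb{C}^d$ write $\langle x, z\rangle := x_1 z_1 + \cdots + x_d z_d$ (bilinear, not Hermitian). The Fourier-Laplace transform of $\mathcal{P}$ is the function $\hat 1_{\mathcal{P}} : \mathbb{C}^d \to \mathbb{C}$, $\hat 1_{\mathcal{P}}(z) := \int_{\mathcal{P}} e^{-2\pi i \langle x, z \rangle}\, dx$ (Lebesgue measure on $\mathbb{R}^d$). The null set of $\mathcal{P}$ is $N(\mathcal{P}) := \{\xi \in \mathbb{C}^d \mid \hat 1_{\mathcal{P}}(\xi) = 0\}$. An edge of $\mathcal{P}$ is a $1$-dimensional face; $H$ is orthogonal to an edge if the direction vector of the edge (the difference of its endpoints) is orthogonal to every vector of $H$. *)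

(* Defs.v *)
From HB Require Import structures.
From mathcomp Require Import all_boot all_order all_algebra.
From mathcomp Require Import all_classical all_reals all_analysis.
From mathcomp Require Import complex.

Set Implicit Arguments.
Unset Strict Implicit.
Unset Printing Implicit Defensive.

Import Order.TTheory GRing.Theory Num.Theory.
Import numFieldNormedType.Exports.

Local Open Scope classical_set_scope.
Local Open Scope ring_scope.
Local Open Scope complex_scope.

Definition rV_display : measure_display -> measure_display.
Proof. exact. Qed.

Section measurable_rV.
Context {d} {T : measurableType d}.
Variable n : nat.

Let coords : 'I_n -> 'rV[T]_n -> T := fun i x => x 0 i.

Let rV_set0 : g_sigma_preimage coords set0.
Proof. exact: sigma_algebra0. Qed.

Let rV_setC A : g_sigma_preimage coords A -> g_sigma_preimage coords (~` A).
Proof. exact: sigma_algebraC. Qed.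

Let rV_bigcup (F : (set 'rV[T]_n)^nat) :
  (forall i, g_sigma_preimage coords (F i)) ->
  g_sigma_preimage coords (\bigcup_i (F i)).
Proof. exact: sigma_algebra_bigcup. Qed.

HB.instance Definition _ := @isMeasurable.Build (rV_display d)
  'rV[T]_n (g_sigma_preimage coords) rV_set0 rV_setC rV_bigcup.

End measurable_rV.

Lemma measurable_coord d (T : measurableType d) n (i : 'I_n) :
  measurable_fun [set: 'rV[T]_n] (fun x => x 0 i).
Proof.
move=> _ Y mY; rewrite setTI; apply: sub_sigma_algebra => /=.
rewrite -bigcup_seq/=; exists i => /=; first by rewrite mem_index_enum.
by exists Y => //; rewrite setTI.
Qed.

Lemma measurable_fun_rVP d1 d2 (T1 : measurableType d1) (T2 : measurableType d2)
    n (f : T1 -> 'rV[T2]_n) :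
  measurable_fun [set: T1] f <->
  forall i, measurable_fun [set: T1] (fun x => f x 0 i).
Proof.
split=> [mf i|mf].
  exact: (measurableT_comp (@measurable_coord _ T2 n i) mf).
move=> _ Y mY; rewrite setTI.
have : g_sigma_preimage (fun (i : 'I_n) (x : 'rV[T2]_n) => x 0 i) Y by [].
apply: (@smallest_sub _ (@sigma_algebra _ setT) _
  [set A : set 'rV[T2]_n | measurable (f @^-1` A)]).
  split => /=; first by rewrite preimage_set0; exact: measurable0.
    by move=> A mA; rewrite setTD preimage_setC; exact: measurableC.
  by move=> F mF; rewrite preimage_bigcup; exact: bigcupT_measurable.
move=> A; rewrite -bigcup_seq => -[i _ [B mB]]; rewrite setTI => <- /=.
by have := mf i measurableT _ mB; rewrite setTI.
Qed.

Section lebesgue_rV.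
Variable R : realType.

Definition rV_cons n (p : R * 'rV[R]_n) : 'rV[R]_n.+1 :=
  row_mx (const_mx p.1 : 'rV_1) p.2.

(* Iterated product of the one-dimensional Lebesgue measure; see lebesgue_rV_box
   for its values on boxes. *)
Fixpoint lebesgue_rV n : set 'rV[R]_n -> \bar R :=
  match n with
  | 0 => \d_(0 : 'rV[R]_0)
  | m.+1 =>
      pushforward (@lebesgue_measure R \x @lebesgue_rV m)%E (@rV_cons m)
  end.

Lemma rV_cons0 n (p : R * 'rV[R]_n) : rV_cons p 0 0 = p.1.
Proof.
rewrite /rV_cons.
have -> : (0 : 'I_n.+1) = lshift n (0 : 'I_1) by apply/val_inj.
by rewrite (row_mxEl (const_mx p.1 : 'rV_1) p.2) mxE.
Qed.

Lemma rV_consS n (p : R * 'rV[R]_n) i : rV_cons p 0 (lift 0 i) = p.2 0 i.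
Proof.
rewrite /rV_cons.
have -> : (lift 0 i : 'I_n.+1) = rshift 1 i by apply/val_inj.
by rewrite (row_mxEr (const_mx p.1 : 'rV_1) p.2).
Qed.

Lemma measurable_rV_cons n : measurable_fun setT (@rV_cons n).
Proof.
apply/measurable_fun_rVP => i; case: (unliftP 0 i) => [j|] ->.
  under eq_fun do rewrite rV_consS.
  exact: (measurableT_comp (@measurable_coord _ _ n j) measurable_snd).
under eq_fun do rewrite rV_cons0.
exact: measurable_fst.
Qed.

Let lebesgue_rV_measure n :
  exists mu : {sigma_finite_measure set 'rV[R]_n -> \bar R},
  @lebesgue_rV n = mu.
Proof.
elim: n => [|n [mu /= muE]].
  by exists (\d_(0 : 'rV[R]_0)).
rewrite /= muE.
pose P := pushforward (@lebesgue_measure R \x mu)%E (@rV_cons n).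
have P0 : P set0 = 0 by rewrite /P /pushforward preimage_set0 measure0.
have Pge A : (0 <= P A)%E by apply: integral_ge0 => x _; exact: measure_ge0.
have mpre A : measurable A -> measurable (@rV_cons n @^-1` A).
  by move=> mA; rewrite -[X in measurable X]setTI; exact: measurable_rV_cons.
have Padd : semi_sigma_additive P.
  move=> F mF tF mUF; rewrite /P /pushforward preimage_bigcup.
  apply: measure_semi_sigma_additive => //.
  - by move=> k; exact: mpre.
  - apply/trivIsetP => /= i j _ _ ij; rewrite -preimage_setI.
    by move/trivIsetP : tF => /(_ _ _ _ _ ij) ->//; rewrite preimage_set0.
  - by rewrite -preimage_bigcup; exact: mpre.
have Psf : sigma_finite setT P.
  have /sigma_finiteP[F [FT ndF Foo]] := sigma_finiteT (@lebesgue_measure R).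
  have /sigma_finiteP[G [GT ndG Goo]] := sigma_finiteT mu.
  pose uncons (x : 'rV[R]_n.+1) : R * 'rV[R]_n :=
    (x 0 0, \row_i x 0 (lift ord0 i)).
  have consK : cancel (@rV_cons n) uncons.
    move=> [a v]; congr pair; first by rewrite rV_cons0.
    by apply/rowP => i; rewrite mxE rV_consS.
  have preK A : @rV_cons n @^-1` (uncons @^-1` A) = A.
    by apply/seteqP; split=> x /=; rewrite consK.
  have muncons : measurable_fun setT uncons.
    apply/measurable_fun_pairP; split; first exact: measurable_coord.
    apply/measurable_fun_rVP => i /=.
    under eq_fun do rewrite mxE.
    exact: measurable_coord.
  exists (fun k => uncons @^-1` (F k `*` G k)).
    apply/seteqP; split=> // x _.
    have [i _ Fi] : (\bigcup_i F i) (uncons x).1 by rewrite -FT.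
    have [j _ Gj] : (\bigcup_i G i) (uncons x).2 by rewrite -GT.
    exists (maxn i j) => //; split => /=.
    - by move: Fi; apply/subsetPset/ndF/leq_maxl.
    - by move: Gj; apply/subsetPset/ndG/leq_maxr.
  move=> k; have [mF Fk] := Foo k; have [mG Gk] := Goo k; split.
    rewrite -[X in measurable X]setTI; apply: muncons => //.
    exact: measurableX.
  rewrite /P /pushforward preK product_measure1E//.
  by rewrite lte_mul_pinfty// ge0_fin_numE.
rewrite -/P; move: P0 Pge Padd Psf; clearbody P => P0 Pge Padd Psf.
pose m1 : {measure set 'rV[R]_n.+1 -> \bar R} :=
  HB.pack P (@isMeasure.Build _ _ _ P P0 Pge Padd).
pose m2 : {sigma_finite_measure set 'rV[R]_n.+1 -> \bar R} :=
  HB.pack (Measure.sort m1) (@Measure_isSigmaFinite.Build _ _ _ m1 Psf).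
by exists m2.
Qed.

Let lebesgue_rV0 n : @lebesgue_rV n set0 = 0.
Proof. by have [mu ->] := lebesgue_rV_measure n; exact: measure0. Qed.

Let lebesgue_rV_ge0 n A : (0 <= @lebesgue_rV n A)%E.
Proof. by have [mu ->] := lebesgue_rV_measure n; exact: measure_ge0. Qed.

Let lebesgue_rV_sigma_additive n : semi_sigma_additive (@lebesgue_rV n).
Proof.
by have [mu ->] := lebesgue_rV_measure n; exact: measure_semi_sigma_additive.
Qed.

HB.instance Definition _ n := isMeasure.Build _ _ _ (@lebesgue_rV n)
  (@lebesgue_rV0 n) (@lebesgue_rV_ge0 n) (@lebesgue_rV_sigma_additive n).

Let lebesgue_rV_sigma_finite n : sigma_finite setT (@lebesgue_rV n).
Proof. by have [mu ->] := lebesgue_rV_measure n; exact: sigma_finiteT. Qed.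

HB.instance Definition _ n := Measure_isSigmaFinite.Build _ _ _
  (@lebesgue_rV n) (@lebesgue_rV_sigma_finite n).

Lemma lebesgue_rV_box n (A : 'I_n -> set R) : (forall i, measurable (A i)) ->
  @lebesgue_rV n [set x : 'rV[R]_n | forall i, A i (x 0 i)] =
  (\prod_(i < n) @lebesgue_measure R (A i))%E.
Proof.
elim: n A => [|n IHn] A mA.
  rewrite big_ord0 (_ : mkset _ = setT); first exact: diracT.
  by apply/seteqP; split=> // x _ [].
rewrite big_ord_recl /= -(IHn (fun i => A (lift ord0 i)))//.
have mbox : measurable [set x : 'rV[R]_n | forall i, A (lift ord0 i) (x 0 i)].
  rewrite (_ : mkset _ =
      \bigcap_(i in [set: 'I_n])
        (fun x : 'rV[R]_n => x 0 i) @^-1` A (lift ord0 i)).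
    apply: fin_bigcap_measurable => // i _.
    by rewrite -[X in measurable X]setTI; exact: measurable_coord.
  by apply/seteqP; split=> x /= Ax i; [move=> _; exact: Ax|exact: Ax].
rewrite /pushforward (_ : @rV_cons n @^-1` _ =
    A ord0 `*` [set x : 'rV[R]_n | forall i, A (lift ord0 i) (x 0 i)]).
  exact: (product_measure1E (@lebesgue_measure R) (@lebesgue_rV n) (mA ord0) mbox).
apply/seteqP; split=> p /=.
  move=> Ap; split=> [|i /=]; first by have := Ap 0; rewrite rV_cons0.
  by have := Ap (lift ord0 i); rewrite rV_consS.
move=> [A0 AS] i; case: (unliftP ord0 i) => [j|] ->; rewrite ?rV_consS ?rV_cons0//.
Qed.

End lebesgue_rV.

(* Bilinear, also over the complex numbers: no conjugation. *)
Definition dotv (K : pzSemiRingType) (d : nat) (x y : 'rV[K]_d) : K :=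
  \sum_(i < d) x 0 i * y 0 i.

Section polytopes.
Variables (R : realType) (d : nat).
Implicit Types (P F : set 'rV[R]_d) (H : {vspace 'rV[R]_d}).

Definition convex_hull (A : set 'rV[R]_d) : set 'rV[R]_d :=
  smallest (@convex_set R (convex_lmodType 'rV[R]_d)) A.

Definition polytope P := exists2 A, finite_set A & P = convex_hull A.

Definition full_dimensional P := P° !=set0.

(* The nonempty faces of a polytope P: the sets of maximisers on P of the linear
   functionals (P itself is obtained for the zero functional). *)
Definition face P F := exists c : 'rV[R]_d,
  F = [set x | P x /\ forall y, P y -> dotv c y <= dotv c x].

(* k is the dimension of the affine hull x + U of F. *)
Definition affine_dim F (k : nat) :=
  exists (x : 'rV[R]_d) (U : {vspace 'rV[R]_d}),
    [/\ F x,
        forall y, F y -> y - x \in U,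
        forall V : {vspace 'rV[R]_d},
          (forall y, F y -> y - x \in V) -> (U <= V)%VS
      & \dim U = k].

Definition edge P F := face P F /\ affine_dim F 1.

(* A one-dimensional face of a polytope is a segment [u, v] with u != v, which
   determines its endpoints up to order. *)
Definition endpoints F (u v : 'rV[R]_d) := F = convex_hull [set u; v].

Definition orthogonal_to_edge H F := exists u v,
  endpoints F u v /\ forall h, h \in H -> dotv (v - u) h = 0.

Definition orthonormal_basis2 H (e f : 'rV[R]_d) :=
  [/\ basis_of H [:: e; f], dotv e e = 1, dotv f f = 1 & dotv e f = 0].

End polytopes.

Section fourier_laplace.
Variables (R : realType) (d : nat).

Definition toC (x : 'rV[R]_d) : 'rV[R[i]]_d := map_mx (real_complex R) x.

Definition cexp (z : R[i]) : R[i] :=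
  (expR (complex.Re z))%:C * (cos (complex.Im z) +i* sin (complex.Im z)).

Definition cintegral (D : set 'rV[R]_d) (g : 'rV[R]_d -> R[i]) : R[i] :=
  (\int[@lebesgue_rV R d]_(x in D) complex.Re (g x)) +i*
  (\int[@lebesgue_rV R d]_(x in D) complex.Im (g x)).

Definition fourier_laplace (P : set 'rV[R]_d) (z : 'rV[R[i]]_d) : R[i] :=
  cintegral P (fun x => cexp (- ((0 +i* (2 * pi)) * dotv (toC x) z))).

Definition transform_null_set (P : set 'rV[R]_d) : set 'rV[R[i]]_d :=
  [set xi | fourier_laplace P xi = 0].

Definition circle (alpha : R[i]) (e f : 'rV[R]_d) : set 'rV[R[i]]_d :=
  [set (alpha * (cos t)%:C) *: toC e + (alpha * (sin t)%:C) *: toC f |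
    t in `[- pi, pi]].

End fourier_laplace.

(* Main.v *)
Require Import Defs.
From mathcomp Require Import all_boot all_order all_algebra.
From mathcomp Require Import all_classical all_reals all_analysis.
From mathcomp Require Import measurable_realfun complex.
From mathcomp Require Import ring lra.

(** Put zeta x = <x, e> + i <x, f> and A = - i pi alpha. At the point of the
    circle with parameter w = exp (i t), the transform of P is
      F (w) = \int_P exp (A (w conj (zeta x) + zeta x / w)) dx,
    which makes sense for every nonzero complex number w. As F is the sum of a
    Laurent series, it vanishes everywhere as soon as it vanishes on the unit
    circle ([cint_laurent_vanish]).

    For all but finitely many t, two generators of P with the same value of
    <_, e + t f> differ by a vector orthogonal to H. The face of P on which
    p = e + t f is minimal is then orthogonal to H, and so are its edges; as
    there is no such edge, that face is a vertex V ([exposed_vertex]). Let K be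
    the cone of apex V spanned by P: it is contained in P up to some height
    delta > 0 above V ([vertex_cone_trunc]). Let z be the complex coordinate of
    x - V whose real part is this height: |z| <= C Re z on K.

    A suitable choice of w turns F (w) = 0 into
      \int_P exp (- s conj z - (B / s) z) = 0   for all s > 0,
    where B is a nonzero constant ([exposed_vertex_transform]). The integral over
    K of the same function is therefore O (exp (- c s)) for large s. A dilation
    by s identifies it with s ^ - d h (B / s ^ 2), where
      h (u) = \int_K exp (- conj z - u z),
    so that h is flat at u = 0 ([cone_moment_flat]). But h is analytic along
    u >= 0, with a radius of convergence bounded below: all its derivatives vanish
    at 0 ([cone_moments_eq0_of_flat]), hence also at every u in [0, 1]
    ([cone_moments_continue]), and this contradicts
      h (1) = \int_K exp (- 2 Re z) > 0   ([cone_transform_neq0]).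

    Letting s tend to infinity amounts to approaching the isotropic direction
    e - i f of the complexified plane; going on to u = 1 is what brings the
    argument back to a real direction, where positivity can be used. *)

Set Implicit Arguments.
Unset Strict Implicit.
Unset Printing Implicit Defensive.

Import Order.TTheory GRing.Theory Num.Theory.
Import numFieldNormedType.Exports.

Local Open Scope classical_set_scope.
Local Open Scope ring_scope.
Local Open Scope complex_scope.

Local Notation normc := ComplexField.Normc.normc.

(** * The complex exponential and its Taylor polynomials *)

Section modulus.
Variable R : realType.
Implicit Types z w : R[i].

Lemma normc_ge0 z : 0 <= normc z.
Proof. by case: z => a b; exact: sqrtr_ge0. Qed.

Lemma normc_eq0 z : (normc z == 0) = (z == 0).
Proof.
apply/eqP/eqP => [/ComplexField.Normc.eq0_normc//|->].
exact: ComplexField.Normc.normc0.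
Qed.

Lemma Re_le_normc z : `|complex.Re z| <= normc z.
Proof.
case: z => a b /=; rewrite -sqrtr_sqr ler_wsqrtr// lerDl; exact: sqr_ge0.
Qed.

Lemma Im_le_normc z : `|complex.Im z| <= normc z.
Proof.
case: z => a b /=; rewrite -sqrtr_sqr ler_wsqrtr// lerDr; exact: sqr_ge0.
Qed.

Lemma normc_le_ReIm z : normc z <= `|complex.Re z| + `|complex.Im z|.
Proof.
case: z => a b /=; rewrite -[leRHS]ger0_norm ?addr_ge0//.
rewrite -sqrtr_sqr ler_wsqrtr// sqrrD !real_normK ?num_real//.
rewrite lerD2r lerDl mulrn_wge0// mulr_ge0//.
Qed.

Lemma normc_real (x : R) : normc x%:C = `|x|.
Proof. by rewrite /= expr0n/= addr0 sqrtr_sqr. Qed.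

Lemma normcX z n : normc (z ^+ n) = normc z ^+ n.
Proof.
elim: n => [|n IHn]; first by rewrite !expr0 ComplexField.Normc.normc1.
by rewrite !exprS ComplexField.Normc.normcM IHn.
Qed.

Lemma normc_sum (I : Type) (r : seq I) (P : pred I) (F : I -> R[i]) :
  normc (\sum_(i <- r | P i) F i) <= \sum_(i <- r | P i) normc (F i).
Proof.
elim/big_ind2 : _ => [|x1 x2 y1 y2 xy1 xy2|//].
  by rewrite ComplexField.Normc.normc0.
exact: le_trans (le_normcD _ _) (lerD xy1 xy2).
Qed.

Lemma normc_nat n : normc (n%:R : R[i]) = n%:R.
Proof.
by rewrite (_ : n%:R = (n%:R : R)%:C) ?normc_real ?ger0_norm// rmorph_nat.
Qed.

End modulus.

Section exponential_polynomial.

Definition exp_poly (K : fieldType) n (z : K) : K :=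
  \sum_(j < n) z ^+ j / j`!%:R.

Lemma natf_fact_neq0 (K : numFieldType) n : n`!%:R != 0 :> K.
Proof. by rewrite pnatr_eq0 -lt0n fact_gt0. Qed.

Lemma exp_poly_split (K : fieldType) k n (x : K) :
  exp_poly (k + n) x =
  exp_poly k x + \sum_(i < n) x ^+ (k + i) / (k + i)`!%:R.
Proof. by rewrite /exp_poly big_split_ord. Qed.

Lemma exp_term_binomial (K : numFieldType) m (x y : K) :
  (x + y) ^+ m / m`!%:R =
  \sum_(i < m.+1) x ^+ i / i`!%:R * (y ^+ (m - i) / (m - i)`!%:R).
Proof.
rewrite addrC exprDn mulr_suml; apply: eq_bigr => i _.
have im : (i <= m)%N by rewrite -ltnS.
rewrite -mulr_natr -(bin_fact im) !natrM.
have := natf_fact_neq0 K i; have := natf_fact_neq0 K (m - i)%N.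
have : 'C(m, i)%:R != 0 :> K by rewrite pnatr_eq0 -lt0n bin_gt0.
by move=> ? ? ?; field; do ?[apply/andP; split].
Qed.

(** The binomial theorem shows that truncating exp (x + y) keeps the terms of
    total degree less than n in the product of the two truncations. *)
Lemma exp_polyD (K : numFieldType) n (x y : K) :
  exp_poly n x * exp_poly n y - exp_poly n (x + y) =
  \sum_(i < n) \sum_(j < n | (n <= i + j)%N)
    x ^+ i / i`!%:R * (y ^+ j / j`!%:R).
Proof.
have -> : exp_poly n (x + y) = \sum_(i < n) \sum_(j < n | (i + j < n)%N)
    x ^+ i / i`!%:R * (y ^+ j / j`!%:R).
  rewrite /exp_poly; under eq_bigr do rewrite exp_term_binomial.
  under eq_bigr => m _.
    rewrite (big_ord_widen_cond n xpredT
      (fun i => x ^+ i / i`!%:R * (y ^+ (m - i) / (m - i)`!%:R)))//=.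
    over.
  rewrite (exchange_big_dep xpredT)//=; apply: eq_bigr => i _.
  under eq_bigl do rewrite ltnS.
  rewrite -(big_mkord (fun m => (i <= m)%N)
    (fun m => x ^+ i / i`!%:R * (y ^+ (m - i) / (m - i)`!%:R))).
  rewrite -(big_mkord (fun m => (i + m < n)%N)
    (fun m => x ^+ i / i`!%:R * (y ^+ m / m`!%:R))).
  have ni := ltnW (ltn_ord i).
  rewrite (big_cat_nat (n := i))//= big_nat_cond big1 ?add0r; last first.
    by move=> m /andP[/andP[_ mi] im]; move: mi; rewrite ltnNge im.
  rewrite [RHS](big_cat_nat (n := n - i))//=; last exact: leq_subr.
  rewrite [X in _ + X]big_nat_cond [X in _ + X]big1 ?addr0; last first.
    by move=> m /andP[/andP[nim _]]; rewrite -ltn_subRL ltnNge nim.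
  rewrite -{1}[X in index_iota X _]add0n big_addn.
  rewrite big_nat_cond [RHS]big_nat_cond.
  apply: eq_big => [m|m _]; last by rewrite addnK.
  by rewrite leq_addl andbT -ltn_subRL -andbA andbb.
rewrite /exp_poly mulr_suml -sumrB; apply: eq_bigr => i _.
rewrite mulr_sumr (bigID (fun j : 'I_n => (i + j < n)%N))/= addrC addrK.
by apply: eq_bigl => j; rewrite -leqNgt.
Qed.

Variable R : realType.

Lemma normc_exp_term (z : R[i]) n :
  normc (z ^+ n / n`!%:R) = normc z ^+ n / n`!%:R.
Proof.
by rewrite ComplexField.Normc.normcM ComplexField.Normc.normcV normcX normc_nat.
Qed.

(** The defect in [exp_polyD] has nonnegative coefficients, so it is dominated
    by its value at the moduli, where it tends to 0 by the real functional
    equation of the exponential. *)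
Lemma normc_exp_polyD n (x y : R[i]) :
  normc (exp_poly n x * exp_poly n y - exp_poly n (x + y)) <=
  exp_poly n (normc x) * exp_poly n (normc y) - exp_poly n (normc x + normc y).
Proof.
rewrite !exp_polyD; apply: le_trans (normc_sum _ _ _) _.
apply: ler_sum => i _; apply: le_trans (normc_sum _ _ _) _.
by apply: ler_sum => j _; rewrite ComplexField.Normc.normcM !normc_exp_term.
Qed.

Lemma exp_poly_series n (x : R) : exp_poly n x = series (exp_coeff x) n.
Proof. by rewrite /exp_poly /series/= big_mkord. Qed.

Lemma cvg_exp_poly (x : R) : exp_poly n x @[n --> \oo] --> expR x.
Proof.
under eq_fun do rewrite exp_poly_series.
exact: is_cvg_series_exp_coeff.
Qed.

Lemma exp_poly_le (x : R) n : 0 <= x -> exp_poly n x <= expR x.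
Proof.
move=> x0; rewrite -(cvg_lim _ (@cvg_exp_poly x))//.
apply: (@nondecreasing_cvgn_le _ (fun n => exp_poly n x)).
  apply/nondecreasing_seqP => m; rewrite /exp_poly big_ord_recr/= lerDl.
  by rewrite divr_ge0// exprn_ge0.
by apply/cvg_ex; eexists; exact: cvg_exp_poly.
Qed.

Lemma exp_term_le (x : R) n : 0 <= x -> x ^+ n / n`!%:R <= expR x.
Proof.
move=> x0; apply: le_trans (exp_poly_le n.+1 x0).
rewrite /exp_poly big_ord_recr/= lerDr sumr_ge0// => i _.
by rewrite divr_ge0// exprn_ge0.
Qed.

Lemma exp_poly_real n (x : R) : exp_poly n x%:C = (exp_poly n x)%:C.
Proof.
rewrite /exp_poly rmorph_sum/=; apply: eq_bigr => j _.
by rewrite rmorphM rmorphXn fmorphV rmorph_nat.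
Qed.

(** Separating the even and odd powers of i y gives the partial sums of the series
    of cosine and sine. *)
Lemma exp_poly_imag n (y : R) :
  exp_poly n (0 +i* y) =
  series (cos_coeff y) n +i* series (sin_coeff y) n.
Proof.
rewrite /exp_poly /series/= !big_mkord; elim: n => [|n IHn].
  by rewrite !big_ord0.
rewrite !big_ord_recr/= IHn.
suff -> : (0 +i* y) ^+ n / n`!%:R = cos_coeff y n +i* sin_coeff y n by [].
have -> : 0 +i* y = 'i * y%:C by simpc.
rewrite exprMn -[in 'i ^+ n](odd_double_half n) exprD -mul2n exprM sqr_i.
rewrite (_ : n`!%:R^-1 = (n`!%:R^-1)%:C); last by rewrite fmorphV rmorph_nat.
rewrite (_ : (-1) ^+ n./2 = ((-1) ^+ n./2 : R)%:C); last first.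
  by rewrite rmorphXn rmorphN1.
rewrite -rmorphXn /cos_coeff /sin_coeff/=.
case: (boolP (odd n)) => on; rewrite /= ?expr0 ?expr1; simpc => //.
suff -> : (n./2 = n.-1./2)%N by [].
by case: n on {IHn} => //= m mo; rewrite uphalf_half (negbTE mo).
Qed.

Lemma cvg_exp_poly_imag_Re (y : R) :
  series (cos_coeff y) n @[n --> \oo] --> cos y.
Proof. by rewrite unlock; exact: is_cvg_series_cos_coeff. Qed.

Lemma cvg_exp_poly_imag_Im (y : R) :
  series (sin_coeff y) n @[n --> \oo] --> sin y.
Proof. by rewrite unlock; exact: is_cvg_series_sin_coeff. Qed.

(** For z = x + i y the product of the truncations at x and at i y converges to
    expR x (cos y + i sin y), and it is close to the truncation at x + i y. *)
Lemma cvg_exp_poly_cexp (z : R[i]) :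
  normc (cexp z - exp_poly n z) @[n --> \oo] --> (0 : R).
Proof.
case: z => x y.
pose C n := series (cos_coeff y) n; pose S n := series (sin_coeff y) n.
pose E n := exp_poly n x.
pose D n := exp_poly n `|x| * exp_poly n `|y| - exp_poly n (`|x| + `|y|).
pose u n := `|expR x * cos y - E n * C n| +
            `|expR x * sin y - E n * S n| + D n.
apply: (@squeeze_cvgr _ _ _ _ (cst 0) u); [|exact: cvg_cst|].
  apply: nearW => n; rewrite normc_ge0/=.
  have -> : cexp (x +i* y) - exp_poly n (x +i* y) =
      (cexp (x +i* y) - exp_poly n x%:C * exp_poly n (0 +i* y)) +
      (exp_poly n x%:C * exp_poly n (0 +i* y) - exp_poly n (x%:C + 0 +i* y)).
    rewrite [in X in _ = _ + (_ - X)](_ : x%:C + 0 +i* y = x +i* y).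
      by rewrite addrA subrK.
    by simpc.
  apply: le_trans (le_normcD _ _) _; apply: lerD.
    have -> : cexp (x +i* y) - exp_poly n x%:C * exp_poly n (0 +i* y) =
        (expR x * cos y - E n * C n) +i* (expR x * sin y - E n * S n).
      by rewrite exp_poly_real exp_poly_imag /cexp /E /C /S; simpc.
    exact: normc_le_ReIm.
  apply: le_trans (normc_exp_polyD _ _ _) _.
  by rewrite normc_real/= expr0n/= add0r sqrtr_sqr.
rewrite [X in _ --> X](_ : 0 = `|expR x * cos y - expR x * cos y| +
   `|expR x * sin y - expR x * sin y| +
   (expR `|x| * expR `|y| - expR (`|x| + `|y|)));
   last by rewrite !subrr normr0 expRD subrr !addr0.
apply: cvgD; first apply: cvgD.
- apply: cvg_norm; apply: cvgB; first exact: cvg_cst.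
  by apply: cvgM; [exact: cvg_exp_poly|exact: cvg_exp_poly_imag_Re].
- apply: cvg_norm; apply: cvgB; first exact: cvg_cst.
  by apply: cvgM; [exact: cvg_exp_poly|exact: cvg_exp_poly_imag_Im].
- by apply: cvgB; [apply: cvgM|]; exact: cvg_exp_poly.
Qed.

Lemma fact_mul_le m k : (m`! * k`! <= (m + k)`!)%N.
Proof.
by rewrite -(bin_fact (leq_addr k m)) addKn leq_pmull// bin_gt0 leq_addr.
Qed.

(** Since k! i! <= (k + i)!, the tail of the series is at most its first term
    times the whole series. *)
Lemma exp_poly_tail_le (x : R) k n : 0 <= x ->
  exp_poly (k + n) x - exp_poly k x <= x ^+ k / k`!%:R * expR x.
Proof.
move=> x0; rewrite exp_poly_split addrC addKr.
apply: (@le_trans _ _ (x ^+ k / k`!%:R * exp_poly n x)); last first.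
  by rewrite ler_wpM2l ?divr_ge0 ?exprn_ge0// exp_poly_le.
rewrite /exp_poly mulr_sumr; apply: ler_sum => i _.
rewrite exprD mulrACA -mulrA -[leRHS]mulrA ler_wpM2l ?exprn_ge0//.
rewrite ler_wpM2l ?exprn_ge0// -invfM -natrM lef_pV2 ?posrE ?ltr0n ?muln_gt0 ?fact_gt0//.
by rewrite ler_nat fact_mul_le.
Qed.

(** This passes to the limit in the bound for the polynomial
    exp_poly n z - exp_poly k z. *)
Lemma cexp_taylor k (z : R[i]) :
  normc (cexp z - exp_poly k z) <=
  normc z ^+ k / k`!%:R * expR (normc z).
Proof.
rewrite -[leRHS]add0r.
have cv : normc (cexp z - exp_poly n z) +
    normc z ^+ k / k`!%:R * expR (normc z) @[n --> \oo] -->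
    0 + normc z ^+ k / k`!%:R * expR (normc z).
  by apply: cvgD; [exact: cvg_exp_poly_cexp|exact: cvg_cst].
rewrite -(cvg_lim _ cv)//; apply: limr_ge; first by apply/cvg_ex; eexists; exact: cv.
near=> n; have kn : (k <= n)%N by near: n; exact: nbhs_infty_ge.
rewrite (_ : cexp z - exp_poly k z =
  (cexp z - exp_poly n z) + (exp_poly n z - exp_poly k z)); last first.
  by rewrite addrA subrK.
apply: le_trans (le_normcD _ _) _; rewrite lerD2l.
apply: le_trans (exp_poly_tail_le k (n - k) (normc_ge0 z)).
rewrite -{1}(subnKC kn) !exp_poly_split addrC addKr [leRHS]addrC addKr.
apply: le_trans (normc_sum _ _ _) _; apply: ler_sum => i _.
by rewrite normc_exp_term.
Unshelve. all: by end_near. Qed.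

Lemma cexpD (z w : R[i]) : cexp (z + w) = cexp z * cexp w.
Proof.
case: z w => [a b] [c d]; rewrite /cexp/= expRD cosD sinD; simpc.
by congr (_ +i* _); ring.
Qed.

Lemma normc_cexp (z : R[i]) : normc (cexp z) = expR (complex.Re z).
Proof.
case: z => a b; rewrite /cexp/=; simpc; rewrite /= !exprMn -mulrDr.
by rewrite cos2Dsin2 mulr1 sqrtr_sqr ger0_norm// expR_ge0.
Qed.

End exponential_polynomial.

(** * Integrals of complex-valued functions *)

Section complex_components.
Variable R : realType.
Implicit Types z w : R[i].

Lemma complexReD z w : complex.Re (z + w) = complex.Re z + complex.Re w.
Proof. by case: z; case: w. Qed.

Lemma complexImD z w : complex.Im (z + w) = complex.Im z + complex.Im w.
Proof. by case: z; case: w. Qed.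

Lemma complexReM z w : complex.Re (z * w) =
  complex.Re z * complex.Re w - complex.Im z * complex.Im w.
Proof. by case: z; case: w. Qed.

Lemma complexImM z w : complex.Im (z * w) =
  complex.Re z * complex.Im w + complex.Im z * complex.Re w.
Proof. by case: z; case: w. Qed.

Lemma conjcD z w : conjc (z + w) = conjc z + conjc w.
Proof. by case: z w => [a b] [c d]; congr (_ +i* _); rewrite opprD. Qed.

Lemma conjcM z w : conjc (z * w) = conjc z * conjc w.
Proof. by case: z w => [a b] [c d]; congr (_ +i* _); ring. Qed.

Lemma conjcZr (s : R) z : conjc (s%:C * z) = s%:C * conjc z.
Proof. by case: z => p q; simpc. Qed.

End complex_components.

Section complex_measurable.
Context d (T : measurableType d) (R : realType).
Implicit Types (D : set T) (f g : T -> R[i]).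

Definition cmeasurable D f :=
  measurable_fun D (fun x => complex.Re (f x)) /\
  measurable_fun D (fun x => complex.Im (f x)).

Lemma cmeasurable_cst D (c : R[i]) : cmeasurable D (fun=> c).
Proof. by split; exact: measurable_cst. Qed.

Lemma cmeasurableD D f g : cmeasurable D f -> cmeasurable D g ->
  cmeasurable D (fun x => f x + g x).
Proof.
move=> [f1 f2] [g1 g2]; split.
  by under eq_fun do rewrite complexReD; exact: measurable_funD.
by under eq_fun do rewrite complexImD; exact: measurable_funD.
Qed.

Lemma cmeasurableM D f g : cmeasurable D f -> cmeasurable D g ->
  cmeasurable D (fun x => f x * g x).
Proof.
move=> [f1 f2] [g1 g2]; split.
  by under eq_fun do rewrite complexReM; apply: measurable_funB; exact: measurable_funM.
by under eq_fun do rewrite complexImM; apply: measurable_funD; exact: measurable_funM.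
Qed.

Lemma cmeasurableN D f : cmeasurable D f -> cmeasurable D (fun x => - f x).
Proof.
move=> mf; under eq_fun do rewrite -mulN1r.
by apply: cmeasurableM => //; exact: cmeasurable_cst.
Qed.

Lemma cmeasurableX D f n : cmeasurable D f -> cmeasurable D (fun x => f x ^+ n).
Proof.
move=> mf; elim: n => [|n IHn]; first exact: cmeasurable_cst.
by under eq_fun do rewrite exprS; exact: cmeasurableM.
Qed.

Lemma cmeasurable_conj D f : cmeasurable D f -> cmeasurable D (fun x => conjc (f x)).
Proof.
move=> [f1 f2]; split.
  rewrite (_ : (fun _ => _) = fun x => complex.Re (f x))//.
  by apply/funext => x; case: (f x).
rewrite (_ : (fun _ => _) = fun x => - complex.Im (f x)).
  exact: measurableT_comp.
by apply/funext => x; case: (f x).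
Qed.

Lemma cmeasurable_sum D (I : Type) (s : seq I) (F : I -> T -> R[i]) :
  (forall i, cmeasurable D (F i)) -> cmeasurable D (fun x => \sum_(i <- s) F i x).
Proof.
move=> mF; elim: s => [|i s IHs].
  by under eq_fun do rewrite big_nil; exact: cmeasurable_cst.
by under eq_fun do rewrite big_cons; exact: cmeasurableD.
Qed.

Lemma cmeasurable_cexp D f : cmeasurable D f -> cmeasurable D (fun x => cexp (f x)).
Proof.
move=> [f1 f2]; rewrite /cexp; apply: cmeasurableM; split => /=.
- by apply: measurableT_comp => //; exact: measurable_expR.
- exact: measurable_cst.
- apply: (measurableT_comp _ f2); apply: continuous_measurable_fun.
  exact: continuous_cos.
- apply: (measurableT_comp _ f2); apply: continuous_measurable_fun.
  exact: continuous_sin.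
Qed.

Lemma cmeasurable_exp_poly D f n :
  cmeasurable D f -> cmeasurable D (fun x => exp_poly n (f x)).
Proof.
move=> mf; apply: cmeasurable_sum => i; apply: cmeasurableM.
  exact: cmeasurableX.
exact: cmeasurable_cst.
Qed.

End complex_measurable.

Section complex_integral.
Context d (T : measurableType d) (R : realType).
Variables (mu : {measure set T -> \bar R}) (D : set T).
Hypothesis mD : measurable D.
Implicit Types (f g : T -> R[i]) (G : T -> R).

Lemma integrableZl_EFin (k : R) G : mu.-integrable D (EFin \o G) ->
  mu.-integrable D (EFin \o (fun x => k * G x)).
Proof. by move=> iG; exact: (integrableZl mD k iG). Qed.

Definition cint f : R[i] :=
  (\int[mu]_(x in D) complex.Re (f x)) +i*
  (\int[mu]_(x in D) complex.Im (f x)).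

Definition cintegrable f :=
  mu.-integrable D (fun x => (complex.Re (f x))%:E) /\
  mu.-integrable D (fun x => (complex.Im (f x))%:E).

Lemma cintegrable_le f G : cmeasurable D f ->
  mu.-integrable D (EFin \o G) -> (forall x, D x -> normc (f x) <= G x) ->
  cintegrable f.
Proof.
move=> [f1 f2] iG fG; split; apply: (le_integrable mD _ _ iG).
- exact/measurable_EFinP.
- move=> x Dx; rewrite /= lee_fin; apply: le_trans (Re_le_normc _) _.
  exact: le_trans (fG _ Dx) (ler_norm _).
- exact/measurable_EFinP.
- move=> x Dx; rewrite /= lee_fin; apply: le_trans (Im_le_normc _) _.
  exact: le_trans (fG _ Dx) (ler_norm _).
Qed.

Lemma eq_cint f g : (forall x, D x -> f x = g x) -> cint f = cint g.
Proof.
by move=> fg; congr (_ +i* _); apply: eq_Rintegral => x; rewrite inE => /fg ->.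
Qed.

Lemma cintegrableD f g : cintegrable f -> cintegrable g ->
  cintegrable (fun x => f x + g x).
Proof.
move=> [f1 f2] [g1 g2]; split.
  under eq_fun do rewrite complexReD EFinD; exact: integrableD.
under eq_fun do rewrite complexImD EFinD; exact: integrableD.
Qed.

Lemma cintD f g : cintegrable f -> cintegrable g ->
  cint (fun x => f x + g x) = cint f + cint g.
Proof.
move=> [f1 f2] [g1 g2]; rewrite /cint.
under eq_Rintegral do rewrite complexReD.
under [X in _ +i* X]eq_Rintegral do rewrite complexImD.
by rewrite !RintegralD.
Qed.

Lemma cintegrableZ (c : R[i]) f : cintegrable f -> cintegrable (fun x => c * f x).
Proof.
move=> [f1 f2]; split.
  under eq_fun do rewrite complexReM EFinB !EFinM.
  by apply: integrableB => //; exact: integrableZl.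
under eq_fun do rewrite complexImM EFinD !EFinM.
by apply: integrableD => //; exact: integrableZl.
Qed.

Lemma cintZ (c : R[i]) f : cintegrable f ->
  cint (fun x => c * f x) = c * cint f.
Proof.
move=> [f1 f2].
have i1 k : mu.-integrable D (fun x => (k * complex.Re (f x))%:E).
  by under eq_fun do rewrite EFinM; exact: integrableZl.
have i2 k : mu.-integrable D (fun x => (k * complex.Im (f x))%:E).
  by under eq_fun do rewrite EFinM; exact: integrableZl.
rewrite /cint.
under eq_Rintegral do rewrite complexReM.
under [X in _ +i* X]eq_Rintegral do rewrite complexImM.
rewrite RintegralB; [|exact: mD|exact: i1|exact: i2].
rewrite RintegralD; [|exact: mD|exact: i2|exact: i1].
rewrite !(RintegralZl _ mD f1) !(RintegralZl _ mD f2).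
by case: c.
Qed.

Lemma cint0 : cint (fun=> 0) = 0.
Proof. by rewrite /cint/= !Rintegral_cst// mul0r. Qed.

Lemma cint_sum (I : eqType) (s : seq I) (F : I -> T -> R[i]) :
  (forall i, i \in s -> cintegrable (F i)) ->
  cintegrable (fun x => \sum_(i <- s) F i x) /\
  cint (fun x => \sum_(i <- s) F i x) = \sum_(i <- s) cint (F i).
Proof.
elim: s => [|i s IHs] iF.
  under eq_fun do rewrite big_nil; rewrite big_nil cint0; split => //.
  by split; exact: integrable0.
have [|IH1 IH2] := IHs.
  by move=> j js; apply: iF; rewrite inE js orbT.
under eq_fun do rewrite big_cons; rewrite big_cons.
have ii : cintegrable (F i) by apply: iF; rewrite mem_head.
by split; [exact: cintegrableD|rewrite cintD// IH2].
Qed.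

(** The factor 2 comes from bounding the real and imaginary parts separately; only
    the order of magnitude matters below. *)
Lemma normc_cint_le f G : cmeasurable D f ->
  mu.-integrable D (EFin \o G) -> (forall x, D x -> normc (f x) <= G x) ->
  normc (cint f) <= 2 * \int[mu]_(x in D) G x.
Proof.
move=> mf iG fG; have [f1 f2] := cintegrable_le mf iG fG.
apply: le_trans (normc_le_ReIm _) _; rewrite mulr_natl mulr2n.
apply: lerD; apply: le_trans (le_normr_Rintegral mD _) _ => //.
  apply: le_Rintegral => //; first exact: integrable_norm.
  by move=> x Dx; exact: le_trans (Re_le_normc _) (fG _ Dx).
apply: le_Rintegral => //; first exact: integrable_norm.
by move=> x Dx; exact: le_trans (Im_le_normc _) (fG _ Dx).
Qed.

End complex_integral.

(** * Polynomials bounded on the unit circle *)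

Section unit_circle.
Variable R : realType.

Lemma normc_cis (t : R) : normc (cos t +i* sin t) = 1.
Proof. by rewrite /= cos2Dsin2 sqrtr1. Qed.

Lemma cisX (t : R) n : (cos t +i* sin t) ^+ n = cos (t *+ n) +i* sin (t *+ n).
Proof.
elim: n => [|n IHn]; first by rewrite expr0 mulr0n cos0 sin0.
by rewrite exprS IHn mulrS cosD sinD; simpc; rewrite [sin t * cos _ + _]addrC.
Qed.

Lemma cis_neq1 (t : R) : 0 < t -> t < pi *+ 2 -> cos t +i* sin t != 1.
Proof.
move=> t0 t2; rewrite eq_complex/= negb_and; apply/orP; left.
have st : 0 < sin (t / 2) by apply: sin_gt0_pi; lra.
have -> : t = (t / 2) *+ 2 by lra.
rewrite cos_mulr2n; have := cos2Dsin2 (t / 2).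
have := exprn_gt0 2 st; move=> s2 cs; apply/eqP => c1; lra.
Qed.

Lemma cis_arg (z : R[i]) : normc z = 1 ->
  exists2 t, t \in `[- pi, pi]%R & z = cos t +i* sin t.
Proof.
case: z => a b /= /(congr1 (fun x => x ^+ 2)).
rewrite expr1n sqr_sqrtr ?addr_ge0 ?sqr_ge0// => ab1.
have a1 : -1 <= a <= 1 by apply/andP; split; nra.
have [apos aK] := acos_def a1; have sa := sin_acos a1.
have s2 : Num.sqrt (1 - a ^+ 2) = `|b|.
  by rewrite -ab1 addrC addKr sqrtr_sqr.
have [b0|b0] := leP 0 b.
  exists (acos a); first by rewrite in_itv/=; move: apos; have := pi_ge0 R; lra.
  by rewrite aK sa s2 ger0_norm.
exists (- acos a); first by rewrite in_itv/=; move: apos; have := pi_ge0 R; lra.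
by rewrite cosN sinN aK sa s2 ltr0_norm// opprK.
Qed.

(** Discrete Fourier inversion: the j-th coefficient is the mean of
    w ^- j * p.[w] over the N-th roots of unity w. *)
Lemma coef_le_unit_circle (p : {poly R[i]}) N (eps : R) j :
  (0 < N)%N -> (size p <= N)%N ->
  (forall w, normc w = 1 -> normc p.[w] <= eps) -> normc p`_j <= eps.
Proof.
move=> N0 pN peps.
have [Nj|jN] := leqP N j.
  rewrite nth_default ?(leq_trans pN)// ComplexField.Normc.normc0.
  by apply: le_trans (peps 1 _); rewrite ?normc_ge0 ?ComplexField.Normc.normc1.
have N0' : N%:R != 0 :> R by rewrite pnatr_eq0 -lt0n.
pose w : R[i] := cos (pi *+ 2 / N%:R) +i* sin (pi *+ 2 / N%:R).
have w0 : w != 0.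
  by rewrite -normc_eq0 normc_cis oner_eq0.
have wN : w ^+ N = 1.
  rewrite cisX -[_ *+ N]mulr_natr mulfVK// cos2pi.
  by rewrite -[pi *+ 2]add0r sinD2pi sin0.
have pi2 : 0 < pi *+ 2 :> R by rewrite pmulrn_lgt0// pi_gt0.
have wm m : (0 < m < N)%N -> w ^+ m != 1.
  move=> /andP[m0 mN]; rewrite cisX -[_ *+ m]mulr_natr; apply: cis_neq1.
    by rewrite mulr_gt0 ?divr_gt0 ?pi2 ?ltr0n.
  by rewrite mulrAC ltr_pdivrMr ?ltr0n// ltr_pM2l ?ltr_nat.
have wlj l : (l < N)%N -> l != j -> w ^+ l / w ^+ j != 1.
  move=> lN; rewrite neq_ltn => /orP[lj|jl].
    apply: contra (wm (j - l)%N _) => [/eqP e|]; last first.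
      by rewrite subn_gt0 lj (leq_ltn_trans (leq_subr _ _)).
    have wl : w ^+ l != 0 by rewrite expf_neq0.
    by rewrite -(inj_eq (mulfI wl)) -exprD subnKC ?(ltnW lj)// mulr1
      -[X in X == _](mul1r) -e mulfVK// expf_neq0.
  rewrite -(subnK (ltnW jl)) exprD mulfK ?expf_neq0// wm//.
  by rewrite subn_gt0 jl (leq_ltn_trans (leq_subr _ _)).
have key : \sum_(k < N) (w ^+ k) ^- j * p.[w ^+ k] = N%:R * p`_j.
  under eq_bigr do rewrite (horner_coef_wide _ pN) mulr_sumr.
  rewrite exchange_big/= (bigD1 (Ordinal jN))//= [X in _ + X]big1 ?addr0; last first.
    move=> l lj. rewrite (eq_bigr (fun k : 'I_N => p`_l * (w ^+ l / w ^+ j) ^+ k)).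
      rewrite -mulr_sumr; have z1 := wlj l (ltn_ord l) lj.
      have := subrX1 (w ^+ l / w ^+ j) N.
      rewrite expr_div_n -!exprM mulnC [(j * N)%N]mulnC !exprM wN !expr1n divr1.
      rewrite subrr => /esym/eqP; rewrite mulf_eq0 subr_eq0 (negPf z1)/= => /eqP ->.
      by rewrite mulr0.
    move=> k _; rewrite mulrCA expr_div_n -!exprM; congr (_ * _).
    by rewrite mulrC [(l * k)%N]mulnC [(j * k)%N]mulnC.
  rewrite (eq_bigr (fun=> p`_j)) ?sumr_const ?card_ord ?mulr_natl// => k _.
  by rewrite mulrCA mulVf ?mulr1// !expf_neq0.
have N0c : (0 : R) < N%:R by rewrite ltr0n.
rewrite -(ler_pM2l N0c) -[N%:R in leLHS]normc_nat -ComplexField.Normc.normcM -key.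
apply: le_trans (normc_sum _ _ _) _.
rewrite mulr_natl -[in leRHS](card_ord N) -sumr_const; apply: ler_sum => k _.
have nw : normc (w ^+ k) = 1 by rewrite normcX normc_cis expr1n.
rewrite ComplexField.Normc.normcM ComplexField.Normc.normcV normcX nw expr1n.
by rewrite invr1 mul1r peps.
Qed.

Lemma horner_le_unit_circle (p : {poly R[i]}) N (eps r : R) w :
  (0 < N)%N -> (size p <= N)%N ->
  (forall w, normc w = 1 -> normc p.[w] <= eps) ->
  1 <= r -> normc w <= r -> normc p.[w] <= N%:R * r ^+ N * eps.
Proof.
move=> N0 pN peps r1 wr; have r0 : 0 <= r by lra.
rewrite (horner_coef_wide _ pN); apply: le_trans (normc_sum _ _ _) _.
rewrite -mulrA mulr_natl -[in leRHS](card_ord N) -sumr_const.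
apply: ler_sum => k _; rewrite ComplexField.Normc.normcM normcX mulrC.
apply: ler_pM => //; rewrite ?exprn_ge0 ?normc_ge0//; last first.
  exact: (coef_le_unit_circle k N0 pN peps).
apply: (@le_trans _ _ (r ^+ k)); first by rewrite lerXn2r ?nnegrE ?normc_ge0.
by rewrite card_ord ler_weXn2l// ltnW.
Qed.

End unit_circle.

(** * Laurent continuation off the unit circle *)

Section laurent_continuation.
Variable R : realType.

Lemma normc_cexp_le (z : R[i]) : normc (cexp z) <= expR (normc z).
Proof.
by rewrite normc_cexp ler_expR; apply: le_trans (ler_norm _) (Re_le_normc _).
Qed.

Lemma normc_exp_poly_le n (z : R[i]) : normc (exp_poly n z) <= expR (normc z).
Proof.
apply: le_trans (exp_poly_le n (normc_ge0 z)).
apply: le_trans (normc_sum _ _ _) _.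
by apply: ler_sum => i _; rewrite normc_exp_term.
Qed.

Lemma exp_polyM_cexp n (a b : R[i]) (L : R) : normc a <= L -> normc b <= L ->
  normc (exp_poly n a * exp_poly n b - cexp (a + b)) <=
  L ^+ n / n`!%:R * (2 * expR L ^+ 2).
Proof.
move=> aL bL; rewrite cexpD.
have L0 : 0 <= L := le_trans (normc_ge0 a) aL.
rewrite (_ : _ - _ = - ((cexp a - exp_poly n a) * exp_poly n b) +
  - (cexp a * (cexp b - exp_poly n b))); last by ring.
apply: le_trans (le_normcD _ _) _; rewrite !normcN.
rewrite (ComplexField.Normc.normcM (_ - _)) (ComplexField.Normc.normcM (cexp a)).
have tl z : normc z <= L ->
    normc (cexp z - exp_poly n z) <= L ^+ n / n`!%:R * expR L.
  move=> zL; apply: le_trans (cexp_taylor n z) _; apply: ler_pM.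
  - by rewrite divr_ge0// exprn_ge0// normc_ge0.
  - exact: expR_ge0.
  - by rewrite ler_wpM2r// lerXn2r// nnegrE ?normc_ge0//.
  - by rewrite ler_expR.
have tb : normc (exp_poly n b) <= expR L.
  by apply: le_trans (normc_exp_poly_le _ _) _; rewrite ler_expR.
have ta : normc (cexp a) <= expR L.
  by apply: le_trans (normc_cexp_le _) _; rewrite ler_expR.
have -> : L ^+ n / n`!%:R * (2 * expR L ^+ 2) =
  L ^+ n / n`!%:R * expR L * expR L + expR L * (L ^+ n / n`!%:R * expR L).
  by ring.
by apply: lerD; apply: ler_pM;
  first [exact: normc_ge0|exact: tl|exact: ta|exact: tb].
Qed.

Context d (T : measurableType d).
Variables (mu : {measure set T -> \bar R}) (D : set T).
Hypotheses (mD : measurable D) (Dfin : (mu D < +oo)%E).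

Lemma integrable_cst_set (M : R) : mu.-integrable D (EFin \o cst M).
Proof.
apply: measurable_bounded_integrable => //.
by exists `|M|; split; [exact: num_real|move=> N MN x Dx /=; exact: ltW].
Qed.

Lemma cintegrable_bounded (g : T -> R[i]) (M : R) : cmeasurable D g ->
  (forall x, D x -> normc (g x) <= M) -> cintegrable mu D g.
Proof.
move=> mg gM; apply: (cintegrable_le mD mg (G := cst M)) => //.
exact: integrable_cst_set.
Qed.

Lemma normc_cint_bounded (g : T -> R[i]) (M : R) : cmeasurable D g ->
  (forall x, D x -> normc (g x) <= M) ->
  normc (cint mu D g) <= 2 * (M * fine (mu D)).
Proof.
move=> mg gM; rewrite -(@Rintegral_cst _ _ _ mu D mD M).
apply: normc_cint_le => //; exact: integrable_cst_set.
Qed.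

Variables (u v : T -> R[i]) (M : R).
Hypothesis M0 : 0 <= M.
Hypotheses (mu_ : cmeasurable D u) (mv_ : cmeasurable D v).
Hypotheses (uM : forall x, D x -> normc (u x) <= M).
Hypotheses (vM : forall x, D x -> normc (v x) <= M).

Let trunc n w x := exp_poly n (w * u x) * exp_poly n (w^-1 * v x).
Let term (i j : nat) x := (u x ^+ i / i`!%:R) * (v x ^+ j / j`!%:R).
(* Multiplied by w ^+ n, the Laurent polynomial becomes a polynomial. *)
Let poly_trunc n : {poly R[i]} :=
  \sum_(i < n) \sum_(j < n) (cint mu D (term i j))%:P * 'X^(n + i - j).

Let mterm i j : cmeasurable D (term i j).
Proof.
by apply: cmeasurableM; apply: cmeasurableM;
  [exact: cmeasurableX|exact: cmeasurable_cst|exact: cmeasurableX|exact: cmeasurable_cst].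
Qed.

Let iterm i j : cintegrable mu D (term i j).
Proof.
apply: (@cintegrable_bounded _ (M ^+ i / i`!%:R * (M ^+ j / j`!%:R))) => //.
move=> x Dx; rewrite ComplexField.Normc.normcM !normc_exp_term.
have H k z : normc z <= M -> normc z ^+ k / k`!%:R <= M ^+ k / k`!%:R.
  move=> zM; rewrite ler_wpM2r// lerXn2r// nnegrE ?normc_ge0//.
apply: ler_pM.
- by rewrite divr_ge0// exprn_ge0// normc_ge0.
- by rewrite divr_ge0// exprn_ge0// normc_ge0.
- by apply: H; exact: uM.
- by apply: H; exact: vM.
Qed.

Let trunc_poly n w : w != 0 ->
  (poly_trunc n).[w] = w ^+ n * cint mu D (trunc n w).
Proof.
move=> w0; have -> : trunc n w = fun x =>
    \sum_(i <- index_enum 'I_n) \sum_(j <- index_enum 'I_n)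
      (w ^+ i / w ^+ j) * term i j x.
  apply/funext => x; rewrite /trunc /exp_poly mulr_suml; apply: eq_bigr => i _.
  rewrite mulr_sumr; apply: eq_bigr => j _; rewrite /term !exprMn exprVn.
  by ring.
have ij i : cintegrable mu D
      (fun x => \sum_(j <- index_enum 'I_n) w ^+ i / w ^+ j * term i j x) /\
    cint mu D
      (fun x => \sum_(j <- index_enum 'I_n) w ^+ i / w ^+ j * term i j x) =
    \sum_(j < n) w ^+ i / w ^+ j * cint mu D (term i j).
  have [|a b] := @cint_sum _ _ _ mu D mD _ (index_enum 'I_n)
    (fun (j : 'I_n) x => w ^+ i / w ^+ j * term i j x).
    by move=> j _; exact: cintegrableZ.
  by split=> //; rewrite b; apply: eq_bigr => j _; rewrite cintZ.
have [|_ ->] := @cint_sum _ _ _ mu D mD _ (index_enum 'I_n)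
  (fun (i : 'I_n) x =>
    \sum_(j <- index_enum 'I_n) w ^+ i / w ^+ j * term i j x).
  by move=> i _; have [] := ij i.
rewrite /poly_trunc horner_sum mulr_sumr; apply: eq_bigr => i _.
have [_ ->] := ij i; rewrite horner_sum mulr_sumr; apply: eq_bigr => j _.
rewrite hornerCM hornerXn mulrC !mulrA; congr (_ * _).
have jni : (j <= n + i)%N by rewrite (leq_trans (ltnW (ltn_ord j)))// leq_addr.
by apply: (mulIf (expf_neq0 j w0)); rewrite mulfVK ?expf_neq0// -!exprD subnK.
Qed.

Let trunc_approx n w r x : D x -> normc w <= r -> normc w^-1 <= r ->
  normc (trunc n w x - cexp (w * u x + w^-1 * v x)) <=
  (r * M) ^+ n / n`!%:R * (2 * expR (r * M) ^+ 2).
Proof.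
move=> Dx wr w'r; apply: exp_polyM_cexp; rewrite ComplexField.Normc.normcM.
  by apply: ler_pM; rewrite ?normc_ge0// uM.
by apply: ler_pM; rewrite ?normc_ge0// vM.
Qed.

Let mexp w : cmeasurable D (fun x => cexp (w * u x + w^-1 * v x)).
Proof.
apply: cmeasurable_cexp; apply: cmeasurableD;
  by apply: cmeasurableM => //; exact: cmeasurable_cst.
Qed.

Let mtrunc n w : cmeasurable D (trunc n w).
Proof.
apply: cmeasurableM; apply: cmeasurable_exp_poly;
  by apply: cmeasurableM => //; exact: cmeasurable_cst.
Qed.

Lemma cintegrable_exp_laurent w : cintegrable mu D (fun x => cexp (w * u x + w^-1 * v x)).
Proof.
apply: (@cintegrable_bounded _ (expR (normc w * M + normc w^-1 * M))) => //.
move=> x Dx; apply: le_trans (normc_cexp_le _) _; rewrite ler_expR.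
apply: le_trans (le_normcD _ _) _; rewrite !ComplexField.Normc.normcM.
by apply: lerD; apply: ler_wpM2l; rewrite ?normc_ge0 ?uM ?vM.
Qed.

Let itrunc n w : cintegrable mu D (trunc n w).
Proof.
apply: (@cintegrable_bounded _ (expR (normc w * M) * expR (normc w^-1 * M))) => //.
move=> x Dx; rewrite ComplexField.Normc.normcM.
apply: ler_pM; rewrite ?normc_ge0//; apply: le_trans (normc_exp_poly_le _ _) _;
  rewrite ler_expR ComplexField.Normc.normcM ler_wpM2l ?normc_ge0 ?uM ?vM//.
Qed.

Let cint_approx n w r : normc w <= r -> normc w^-1 <= r ->
  normc (cint mu D (trunc n w) - cint mu D (fun x => cexp (w * u x + w^-1 * v x)))
  <= (r * M) ^+ n / n`!%:R * (4 * expR (r * M) ^+ 2 * fine (mu D)).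
Proof.
move=> wr w'r; have iexp := cintegrable_exp_laurent.
have -> : cint mu D (trunc n w) - cint mu D (fun x => cexp (w * u x + w^-1 * v x))
    = cint mu D (fun x => trunc n w x + (-1) * cexp (w * u x + w^-1 * v x)).
  rewrite cintD ?cintZ// ?mulN1r//; exact: cintegrableZ.
apply: le_trans (@normc_cint_bounded _
  ((r * M) ^+ n / n`!%:R * (2 * expR (r * M) ^+ 2)) _ _) _.
- apply: cmeasurableD => //; apply: cmeasurableM => //; exact: cmeasurable_cst.
- by move=> x Dx; rewrite mulN1r; exact: trunc_approx.
- by rewrite le_eqVlt; apply/orP; left; apply/eqP; ring.
Qed.

(** The integral is a limit of Laurent polynomials in w, of degrees between - n
    and n. On the unit circle they are as small as the truncation error, hence so
    are their coefficients, and their values at a fixed w are larger by a factor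
    that is only geometric in n, whereas the truncation error decreases like
    M ^+ n / n`!. *)
Lemma cint_laurent_vanish :
  (forall w, normc w = 1 ->
    cint mu D (fun x => cexp (w * u x + w^-1 * v x)) = 0) ->
  forall w, w != 0 -> cint mu D (fun x => cexp (w * u x + w^-1 * v x)) = 0.
Proof.
move=> circ w w0.
pose r := Num.max 1 (Num.max (normc w) (normc w^-1)).
have r1 : 1 <= r by rewrite le_max lexx.
have wr : normc w <= r by rewrite !le_max lexx orbT.
have w'r : normc w^-1 <= r by rewrite !le_max lexx !orbT.
have r0 : 0 < r by exact: lt_le_trans r1.
set c0 := cint _ _ _; apply/eqP; rewrite -normc_eq0 eq_le normc_ge0 andbT.
pose K1 := 4 * expR M ^+ 2 * fine (mu D).
pose K2 := 4 * expR (r * M) ^+ 2 * fine (mu D).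
pose bnd n := (4 * r ^+ 3 * M) ^+ n / n`!%:R * K1 + (r * M) ^+ n / n`!%:R * K2.
have K1_ge0 : 0 <= K1 by rewrite !mulr_ge0// ?sqr_ge0 ?fine_ge0.
suff H n : (0 < n)%N -> normc c0 <= bnd n.
  have cb : bnd n @[n --> \oo] --> 0 * K1 + 0 * K2.
    by apply: cvgD; apply: cvgMl; exact: cvg_exp_coeff.
  rewrite !mul0r addr0 in cb.
  rewrite -(cvg_lim _ cb)//; apply: limr_ge; first by apply/cvg_ex; eexists; exact: cb.
  by near=> n; apply: H; near: n; exact: nbhs_infty_gt.
move=> n0; pose eps := M ^+ n / n`!%:R * K1.
have circ_le z : normc z = 1 -> normc (poly_trunc n).[z] <= eps.
  move=> z1; have z0 : z != 0 by rewrite -normc_eq0 z1 oner_eq0.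
  rewrite trunc_poly// ComplexField.Normc.normcM normcX z1 expr1n mul1r.
  have := @cint_approx n z 1; rewrite ComplexField.Normc.normcV z1 invr1 lexx.
  by rewrite (circ z z1) subr0 !mul1r; apply.
have size_le : (size (poly_trunc n) <= 2 * n)%N.
  apply: (leq_trans (size_sum _ _ _)); apply/bigmax_leqP => i _.
  apply: (leq_trans (size_sum _ _ _)); apply/bigmax_leqP => j _.
  rewrite mul_polyC (leq_trans (size_scale_leq _ _))// size_polyXn.
  by rewrite mul2n -addnn (leq_ltn_trans (leq_subr _ _))// ltn_add2l.
rewrite -[c0](subKr (cint mu D (trunc n w))).
apply: le_trans (le_normcD _ _) _; rewrite normcN /bnd; apply: lerD; last first.
  exact: cint_approx.
have -> : cint mu D (trunc n w) = w^-1 ^+ n * (poly_trunc n).[w].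
  by rewrite trunc_poly// mulrA -exprMn mulVf// expr1n mul1r.
rewrite ComplexField.Normc.normcM normcX.
have n2 : (0 < 2 * n)%N by rewrite muln_gt0.
have hb := horner_le_unit_circle n2 size_le circ_le r1 wr.
apply: (@le_trans _ _ (r ^+ n * ((2 * n)%:R * r ^+ (2 * n) * eps))).
  by apply: ler_pM; rewrite ?exprn_ge0 ?normc_ge0// lerXn2r// nnegrE ?normc_ge0// ltW.
have -> : r ^+ n * ((2 * n)%:R * r ^+ (2 * n) * eps) =
    (2 * n)%:R * ((r ^+ 3 * M) ^+ n / n`!%:R * K1).
  have e2 : r ^+ (2 * n) = (r ^+ n) ^+ 2 by rewrite mulnC exprM.
  have e3 : (r ^+ 3) ^+ n = (r ^+ n) ^+ 3 by rewrite -!exprM mulnC.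
  by rewrite /eps e2 exprMn e3; ring.
have -> : (4 * r ^+ 3 * M) ^+ n / n`!%:R * K1 =
    4 ^+ n * ((r ^+ 3 * M) ^+ n / n`!%:R * K1).
  by rewrite -[4 * r ^+ 3 * M]mulrA [in LHS]exprMn !mulrA.
apply: ler_wpM2r.
  rewrite mulr_ge0// divr_ge0// exprn_ge0// mulr_ge0// exprn_ge0//; exact: ltW.
rewrite -natrX ler_nat (_ : 4 = 2 * 2)%N// expnMn.
apply: leq_mul; last exact: ltnW (ltn_expl _ _).
by rewrite -{1}(expn1 2) leq_exp2l.
Unshelve. all: by end_near. Qed.

End laurent_continuation.

(** * Exponential moments over a cone *)

Section cone_moments.
Context d (T : measurableType d) (R : realType).
Variables (mu : {measure set T -> \bar R}) (K : set T) (zeta : T -> R[i]) (C : R).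
Hypotheses (mK : measurable K) (mzeta : cmeasurable K zeta) (C0 : 0 < C).
Hypothesis zetaC : forall x, K x -> normc (zeta x) <= C * complex.Re (zeta x).
Hypothesis expK :
  mu.-integrable K (fun x => (expR (- (complex.Re (zeta x) / 2)))%:E).

(** Up to sign, the k-th derivative with respect to u of the integral of
    exp (- conj zeta - u zeta) over K. *)
Definition cone_moment (u : R[i]) k : R[i] :=
  cint mu K (fun x => zeta x ^+ k * cexp (- conjc (zeta x) - u * zeta x)).

Let Re_ge0 x : K x -> 0 <= complex.Re (zeta x).
Proof.
move=> Kx; have := le_trans (normc_ge0 _) (zetaC Kx).
by rewrite pmulr_rge0.
Qed.

Let normc_pow x k : K x ->
  normc (zeta x ^+ k) <= (8 * C) ^+ k * k`!%:R * expR (complex.Re (zeta x) / 8).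
Proof.
move=> Kx; have a0 := Re_ge0 Kx; set a := complex.Re _ in a0 *.
rewrite normcX; apply: (@le_trans _ _ ((C * a) ^+ k)).
  by rewrite lerXn2r ?nnegrE ?normc_ge0 ?zetaC// mulr_ge0// ltW.
have -> : C * a = 8 * C * (a / 8) by field.
rewrite exprMn -mulrA ler_wpM2l ?exprn_ge0 ?mulr_ge0 ?(ltW C0)//.
rewrite -ler_pdivrMl ?ltr0n ?fact_gt0// mulrC.
by apply: exp_term_le; rewrite divr_ge0.
Qed.

Let normc_tail x n (z : R[i]) theta : K x -> 0 <= theta ->
  normc z <= theta * complex.Re (zeta x) -> theta <= 8^-1 ->
  normc (cexp z - exp_poly n z) <=
  (8 * theta) ^+ n * expR (complex.Re (zeta x) / 4).
Proof.
move=> Kx; have a0 := Re_ge0 Kx; set a := complex.Re _ in a0 * => t0 za t8.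
have z8 : normc z <= a / 8.
  by apply: le_trans za _; rewrite mulrC ler_wpM2l.
apply: le_trans (cexp_taylor n z) _.
have -> : a / 4 = a / 8 + a / 8 by field.
rewrite expRD mulrA; apply: ler_pM => //; last by rewrite ler_expR.
- by rewrite divr_ge0// exprn_ge0// normc_ge0.
- apply: (@le_trans _ _ ((theta * a) ^+ n / n`!%:R)).
    by rewrite ler_wpM2r// lerXn2r// nnegrE ?normc_ge0// mulr_ge0.
  have -> : theta * a = 8 * theta * (a / 8) by field.
  rewrite exprMn -mulrA ler_wpM2l ?exprn_ge0 ?mulr_ge0//.
  by apply: exp_term_le; rewrite divr_ge0.
Qed.

Lemma cmeasurable_cone_moment u k :
  cmeasurable K (fun x => zeta x ^+ k * cexp (- conjc (zeta x) - u * zeta x)).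
Proof.
apply: cmeasurableM; first exact: cmeasurableX.
apply: cmeasurable_cexp; apply: cmeasurableD.
  by apply: cmeasurableN; exact: cmeasurable_conj.
apply: cmeasurableN; apply: cmeasurableM => //; exact: cmeasurable_cst.
Qed.

Let normc_weight x (u : R) : 0 <= u -> K x ->
  normc (cexp (- conjc (zeta x) - u%:C * zeta x)) <= expR (- complex.Re (zeta x)).
Proof.
move=> u0 Kx; have a0 := Re_ge0 Kx; rewrite normc_cexp ler_expR.
case: (zeta x) a0 => a b /= a0; rewrite mul0r subr0 lerBlDr lerDl.
exact: mulr_ge0.
Qed.

Lemma cintegrable_cone_moment (u : R) k : 0 <= u ->
  cintegrable mu K (fun x => zeta x ^+ k * cexp (- conjc (zeta x) - u%:C * zeta x)).
Proof.
move=> u0.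
apply: (cintegrable_le mK (@cmeasurable_cone_moment u%:C k)
  (G := fun x => (8 * C) ^+ k * k`!%:R * expR (- (complex.Re (zeta x) / 2)))).
  exact: integrableZl_EFin.
move=> x Kx; rewrite ComplexField.Normc.normcM.
have -> : - (complex.Re (zeta x) / 2) = complex.Re (zeta x) / 8 +
  (complex.Re (zeta x) * (3 / 8) - complex.Re (zeta x)) by field.
rewrite expRD mulrA; apply: ler_pM; rewrite ?normc_ge0// ?normc_pow//.
apply: le_trans (normc_weight u0 Kx) _; rewrite ler_expR.
have := Re_ge0 Kx; lra.
Qed.

(** On the cone, |w zeta| <= theta Re zeta with theta <= 1 / 8: the Taylor remainder
    of exp (- w zeta) grows at most like exp (Re zeta / 4), which the weight
    exp (- Re zeta) absorbs. The bound does not depend on u, so that the radius of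
    convergence is the same at every u >= 0. *)
Lemma cone_moment_taylor (u : R) (w : R[i]) k n theta : 0 <= u ->
  normc w * C <= theta -> theta <= 8^-1 ->
  normc (cone_moment (u%:C + w) k -
    \sum_(j < n) (- w) ^+ j / j`!%:R * cone_moment u%:C (k + j)) <=
  (8 * theta) ^+ n * (2 * ((8 * C) ^+ k * k`!%:R *
    \int[mu]_(x in K) expR (- (complex.Re (zeta x) / 2)))).
Proof.
move=> u0 wt t8.
have t0 : 0 <= theta by apply: le_trans wt; rewrite mulr_ge0 ?normc_ge0// ltW.
have wz x : K x -> normc (- w * zeta x) <= theta * complex.Re (zeta x).
  move=> Kx; rewrite ComplexField.Normc.normcM normcN.
  apply: (@le_trans _ _ (normc w * (C * complex.Re (zeta x)))).
    by rewrite ler_wpM2l ?normc_ge0 ?zetaC.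
  by rewrite mulrA ler_wpM2r// Re_ge0.
pose P x := \sum_(j <- index_enum 'I_n)
  (- w) ^+ j / j`!%:R * (zeta x ^+ (k + j) * cexp (- conjc (zeta x) - u%:C * zeta x)).
pose W x := zeta x ^+ k * cexp (- conjc (zeta x) - u%:C * zeta x).
have PE x : P x = W x * exp_poly n (- w * zeta x).
  rewrite /P /W /exp_poly mulr_sumr; apply: eq_bigr => j _.
  by rewrite exprMn exprD; ring.
have FE x : zeta x ^+ k * cexp (- conjc (zeta x) - (u%:C + w) * zeta x) =
    W x * cexp (- w * zeta x).
  by rewrite /W -mulrA -cexpD; congr (_ * cexp _); ring.
have bound x : K x ->
    normc (W x * (cexp (- w * zeta x) - exp_poly n (- w * zeta x))) <=
    (8 * theta) ^+ n * ((8 * C) ^+ k * k`!%:R) *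
      expR (- (complex.Re (zeta x) / 2)).
  move=> Kx; rewrite ComplexField.Normc.normcM /W (ComplexField.Normc.normcM (_ ^+ _)).
  have := normc_tail n Kx t0 (wz x Kx) t8.
  have := normc_pow k Kx; have := normc_weight u0 Kx.
  set A := normc _; set B := normc _; set D := normc _ => hA hB hD.
  have -> : (8 * theta) ^+ n * ((8 * C) ^+ k * k`!%:R) *
      expR (- (complex.Re (zeta x) / 2)) =
    ((8 * C) ^+ k * k`!%:R * expR (complex.Re (zeta x) / 8)) *
    expR (- complex.Re (zeta x) + complex.Re (zeta x) / 8) *
    ((8 * theta) ^+ n * expR (complex.Re (zeta x) / 4)).
    have -> : - (complex.Re (zeta x) / 2) = complex.Re (zeta x) / 8 +
      (- complex.Re (zeta x) + complex.Re (zeta x) / 8) +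
      complex.Re (zeta x) / 4 by field.
    by rewrite !expRD; ring.
  apply: ler_pM => //; rewrite ?mulr_ge0 ?normc_ge0//.
  apply: ler_pM => //; rewrite ?normc_ge0//.
  apply: le_trans hA _; rewrite ler_expR lerDl divr_ge0// Re_ge0//.
have mW : cmeasurable K W by exact: cmeasurable_cone_moment.
have mwz : cmeasurable K (fun x => - w * zeta x).
  by apply: cmeasurableM => //; exact: cmeasurable_cst.
have mdiff : cmeasurable K
    (fun x => W x * (cexp (- w * zeta x) - exp_poly n (- w * zeta x))).
  apply: cmeasurableM => //; apply: cmeasurableD; first exact: cmeasurable_cexp.
  by apply: cmeasurableN; exact: cmeasurable_exp_poly.
have [|iP cP] := @cint_sum _ _ _ mu K mK _ (index_enum 'I_n)
    (fun (j : 'I_n) x => (- w) ^+ j / j`!%:R *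
      (zeta x ^+ (k + j) * cexp (- conjc (zeta x) - u%:C * zeta x))).
  by move=> j _; apply: cintegrableZ => //; exact: cintegrable_cone_moment.
have intG : mu.-integrable K (EFin \o (fun x => (8 * theta) ^+ n *
    ((8 * C) ^+ k * k`!%:R) * expR (- (complex.Re (zeta x) / 2)))).
  exact: integrableZl_EFin.
have idiff := cintegrable_le mK mdiff intG bound.
have -> : \sum_(j < n) (- w) ^+ j / j`!%:R * cone_moment u%:C (k + j) =
    cint mu K P.
  by rewrite cP; apply: eq_bigr => j _; rewrite cintZ//; exact: cintegrable_cone_moment.
have -> : cone_moment (u%:C + w) k = cint mu K P +
    cint mu K (fun x => W x * (cexp (- w * zeta x) - exp_poly n (- w * zeta x))).
  rewrite -cintD//; apply: eq_cint => x Kx.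
  by rewrite FE -/(P x) PE -mulrDr addrC subrK.
rewrite addrC addKr; apply: le_trans (normc_cint_le mK mdiff intG bound) _.
by rewrite RintegralZl// le_eqVlt; apply/orP; left; apply/eqP; ring.
Qed.

(** The first nonzero Taylor coefficient of a function at 0 is seen on its values
    near 0, even along a single ray B * v with v > 0. *)
Lemma cone_moments_eq0_of_flat (B : R[i]) : B != 0 ->
  (forall k, exists c v0 : R, 0 < v0 /\ forall v, 0 < v -> v <= v0 ->
    normc (cone_moment (B * v%:C) 0) <= c * v ^+ k) ->
  forall n, cone_moment 0 n = 0.
Proof.
move=> B0 flat n; elim/ltn_ind: n => n IHn.
have nB : 0 < normc B by rewrite lt_neqAle eq_sym normc_eq0 B0 normc_ge0.
have [c [v0 [v00 hv]]] := flat n.+1.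
set I := \int[mu]_(x in K) expR (- (complex.Re (zeta x) / 2)).
pose D := (8 * (normc B * C)) ^+ n.+1 * (2 * ((8 * C) ^+ 0 * 0`!%:R * I)).
pose v1 := Num.min v0 (8 * (normc B * C))^-1.
have v10 : 0 < v1 by rewrite lt_min v00 invr_gt0 !mulr_gt0.
pose X := normc B ^+ n / n`!%:R * normc (cone_moment 0 n).
have XD v : 0 < v -> v <= v1 -> X <= (c + D) * v.
  move=> vp; rewrite le_min => /andP[vv0 vB].
  have ht : normc (B * v%:C) * C <= normc B * C * v.
    by rewrite ComplexField.Normc.normcM normc_real gtr0_norm// mulrAC.
  have t8 : normc B * C * v <= 8^-1.
    have : v * (8 * (normc B * C)) <= 1 by rewrite -ler_pdivlMr ?mulr_gt0// div1r.
    lra.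
  have := cone_moment_taylor 0 n.+1 (lexx 0) ht t8.
  rewrite rmorph0 add0r big_ord_recr/= big1 ?add0r; last first.
    by move=> j _; rewrite IHn ?mulr0 ?ltn_ord.
  move=> tay.
  have : normc ((- (B * v%:C)) ^+ n / n`!%:R * cone_moment 0 n) <=
      c * v ^+ n.+1 + (8 * (normc B * C * v)) ^+ n.+1 *
        (2 * ((8 * C) ^+ 0 * 0`!%:R * I)).
    rewrite -[X in normc X](subKr (cone_moment (B * v%:C) 0)).
    apply: le_trans (le_normcD _ _) _; rewrite normcN; apply: lerD => //.
    exact: hv.
  rewrite ComplexField.Normc.normcM normc_exp_term normcN.
  rewrite (ComplexField.Normc.normcM B) normc_real (gtr0_norm vp) exprMn.
  have -> : (8 * (normc B * C * v)) ^+ n.+1 =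
      (8 * (normc B * C)) ^+ n.+1 * (v ^+ n * v) by rewrite -exprSr mulrA exprMn.
  rewrite [v ^+ n.+1]exprSr => h.
  rewrite -(ler_pM2l (exprn_gt0 n vp)).
  apply: le_trans (le_trans h _).
    by rewrite le_eqVlt; apply/orP; left; apply/eqP; rewrite /X; ring.
  by rewrite le_eqVlt; apply/orP; left; apply/eqP; rewrite /D; ring.
have X0 : X <= 0.
  rewrite leNgt; apply/negP => Xp.
  have cD : 0 < c + D.
    by have := lt_le_trans Xp (XD _ v10 (lexx _)); rewrite pmulr_lgt0.
  pose v := Num.min v1 (X / (2 * (c + D))).
  have vp : 0 < v by rewrite lt_min v10 divr_gt0// mulr_gt0.
  have vv1 : v <= v1 by rewrite ge_min lexx.
  have vX : v <= X / (2 * (c + D)) by rewrite ge_min lexx orbT.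
  have := XD v vp vv1; rewrite leNgt => /negP; apply.
  apply: (@le_lt_trans _ _ ((c + D) * (X / (2 * (c + D))))).
    by rewrite ler_wpM2l// ltW.
  have -> : (c + D) * (X / (2 * (c + D))) = X / 2 by field; rewrite gt_eqF.
  lra.
apply/eqP; rewrite -normc_eq0 eq_le normc_ge0 andbT.
by move: X0; rewrite /X pmulr_rle0// divr_gt0 ?exprn_gt0// ltr0n fact_gt0.
Qed.

(** The moments are analytic in u with a radius of convergence bounded below
    uniformly in u >= 0: they can be continued from 0 to 1 by finitely many
    equal steps. *)
Lemma cone_moments_continue :
  (forall n, cone_moment 0 n = 0) -> cone_moment 1 0 = 0.
Proof.
move=> m0; pose N := (Num.truncn (16 * C)).+1.
have CN : 16 * C < N%:R by exact: truncnS_gt.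
have N0 : (0 : R) < N%:R by rewrite ltr0n.
suff H m k : cone_moment (m%:R / N%:R)%:C k = 0.
  by have := H N 0%N; rewrite divff ?gt_eqF// rmorph1.
elim: m k => [|m IHm] k; first by rewrite mul0r rmorph0.
have hw : normc (N%:R^-1)%:C * C <= 16^-1.
  rewrite normc_real ger0_norm ?invr_ge0 ?ler0n// mulrC ler_pdivrMr//; lra.
have u0 : 0 <= m%:R / N%:R :> R by rewrite divr_ge0.
have e8 : 16^-1 <= 8^-1 :> R by lra.
set c := 2 * ((8 * C) ^+ k * k`!%:R *
    \int[mu]_(x in K) expR (- (complex.Re (zeta x) / 2))).
have tay n : normc (cone_moment (m.+1%:R / N%:R)%:C k) <= 2^-1 ^+ n * c.
  have := cone_moment_taylor k n u0 hw e8.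
  rewrite big1 ?subr0; last by move=> j _; rewrite IHm mulr0.
  rewrite -rmorphD -[X in _ / _ + X]div1r -mulrDl natr1.
  by rewrite (_ : 8 * 16^-1 = 2^-1)//; field.
apply/eqP; rewrite -normc_eq0 eq_le normc_ge0 andbT.
have cb : 2^-1 ^+ n * c @[n --> \oo] --> 0 * c.
  apply: cvgMl; apply: cvg_expr; rewrite ger0_norm; lra.
rewrite mul0r in cb.
rewrite -(cvg_lim _ cb)//; apply: limr_ge; first by apply/cvg_ex; eexists; exact: cb.
exact: nearW.
Qed.

End cone_moments.

(** * Lebesgue measure under homotheties *)

Section scaling.
Variable R : realType.

Lemma lebesgue_measure_affine (s c : R) (A : set R) : 0 < s -> measurable A ->
  lebesgue_measure ((fun r => s * r + c) @^-1` A) =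
  ((s^-1)%:E * lebesgue_measure A)%E.
Proof.
move=> s0 mA.
pose phi : measurableTypeR R -> measurableTypeR R := fun r => s * r + c.
have mphi : measurable_fun setT phi.
  apply: measurable_funD => //; exact: measurable_funM.
have s0' : 0 <= s by exact: ltW.
pose m : {measure set (measurableTypeR R) -> \bar R} :=
  mscale (NngNum s0') (measure_function_pushforward__canonical__measure_function_Measure lebesgue_measure mphi).
have mX X : m X = (s%:E * lebesgue_measure (phi @^-1` X))%E by [].
have -> : lebesgue_measure A = m A.
  apply: lebesgue_measure_unique => // _ [[a b] _ <-].
  rewrite mX.
  rewrite (_ : _ @^-1` _ = `](a - c) / s, (b - c) / s]%classic); last first.
    apply/seteqP; split => x /=; rewrite !in_itv/= /phi => /andP[ax xb].
      by rewrite ltr_pdivrMr// ler_pdivlMr// [x * s]mulrC ltrBlDr lerBrDr ax.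
    by move: ax xb; rewrite ltr_pdivrMr// ler_pdivlMr// [x * s]mulrC ltrBlDr lerBrDr => -> ->.
  rewrite !lebesgue_measure_itv/= !lte_fin ltr_pM2r ?invr_gt0// ltrD2r.
  case: ifPn => _; last by rewrite mule0.
  by rewrite -!EFinD -EFinM; congr EFin; field; rewrite gt_eqF.
by rewrite mX muleA -EFinM mulVf ?gt_eqF// mul1e.
Qed.

Definition rV_homothety n (s : R) (c x : 'rV[R]_n) : 'rV[R]_n := s *: x + c.

Lemma rV_homothetyE n (s : R) (c x : 'rV[R]_n) i :
  rV_homothety s c x 0 i = s * x 0 i + c 0 i.
Proof. by rewrite !mxE. Qed.

Lemma measurable_rV_homothety n (s : R) (c : 'rV[R]_n) :
  measurable_fun setT (rV_homothety s c).
Proof.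
apply/measurable_fun_rVP => i; under eq_fun do rewrite !mxE.
by apply: measurable_funD => //; apply: measurable_funM => //; exact: measurable_coord.
Qed.

(** The measure is an iterated product, and a homothety acts coordinatewise, so
    that the uniqueness of product measures reduces the claim to dimension 1. *)
Lemma lebesgue_rV_homothety n (s : R) (c : 'rV[R]_n) (A : set 'rV[R]_n) :
  0 < s -> measurable A ->
  lebesgue_rV (rV_homothety s c @^-1` A) = ((s ^- n)%:E * lebesgue_rV A)%E.
Proof.
move=> s0; elim: n c A => [|n IHn] c A mA.
  rewrite expr0 invr1 mul1e; congr lebesgue_rV; apply/seteqP.
  by split=> x; rewrite /= (_ : rV_homothety s c x = x)//; apply/rowP; case.
pose c' : 'rV[R]_n := \row_i c 0 (lift ord0 i).
pose phi (p : measurableTypeR R * 'rV[R]_n) : measurableTypeR R * 'rV[R]_n :=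
  (s * p.1 + c 0 0, rV_homothety s c' p.2).
have mphi : measurable_fun setT phi.
  apply/measurable_fun_pairP; split.
    apply: measurable_funD => //; exact: measurable_funM.
  by apply: (measurableT_comp (measurable_rV_homothety s c')).
have s0' : 0 <= s ^+ n.+1 by exact/exprn_ge0/ltW.
pose m : {measure set (measurableTypeR R * 'rV[R]_n) -> \bar R} :=
  mscale (NngNum s0') (measure_function_pushforward__canonical__measure_function_Measure
    (@lebesgue_measure R \x @lebesgue_rV R n)%E mphi).
have mX X : m X = ((s ^+ n.+1)%:E *
  (@lebesgue_measure R \x @lebesgue_rV R n)%E (phi @^-1` X))%E by [].
have mB : measurable (@rV_cons R n @^-1` A).
  by rewrite -[X in measurable X]setTI; exact: measurable_rV_cons.
have mE : (@lebesgue_measure R \x @lebesgue_rV R n)%E (@rV_cons R n @^-1` A) =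
    m (@rV_cons R n @^-1` A).
  apply: product_measure_unique => // X Y mesX mesY.
  rewrite mX.
  rewrite (_ : phi @^-1` (X `*` Y) = ((fun r => s * r + c 0 0) @^-1` X) `*`
    (rV_homothety s c' @^-1` Y))//.
  have mX' : measurable ((fun r : measurableTypeR R => s * r + c 0 0) @^-1` X).
    rewrite -[X in measurable X]setTI.
    by apply: measurable_funD => //; exact: measurable_funM.
  have mY' : measurable (rV_homothety s c' @^-1` Y).
    by rewrite -[X in measurable X]setTI; exact: measurable_rV_homothety.
  rewrite product_measure1E//.
  have e1 := IHn c' Y mesY.
  have e2 := lebesgue_measure_affine (c 0 0) s0 mesX.
  rewrite [X in (_ * (X * _))%E]e2 [X in (_ * (_ * X))%E]e1.
  rewrite [X in (_ * X)%E]muleACA -EFinM [LHS]muleA -EFinM.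
  suff -> : s ^+ n.+1 * (s^-1 / s ^+ n) = 1 by rewrite mul1e.
  by rewrite exprS; field; rewrite expf_neq0 ?gt_eqF.
transitivity ((@lebesgue_measure R \x @lebesgue_rV R n)%E
    (phi @^-1` (@rV_cons R n @^-1` A))).
  suff -> : phi @^-1` (@rV_cons R n @^-1` A) =
    @rV_cons R n @^-1` (rV_homothety s c @^-1` A) by [].
  have consE p : rV_homothety s c (rV_cons p) = rV_cons (phi p).
    apply/rowP => i; rewrite rV_homothetyE.
    case: (unliftP 0 i) => [j|] ->; last by rewrite !rV_cons0.
    by rewrite !rV_consS rV_homothetyE mxE.
  by apply/seteqP; split=> p; rewrite /preimage/= consE.
rewrite [X in _ = (_ * X)%E]mE mX muleA -EFinM mulVf ?mul1e//.
by rewrite expf_neq0 ?gt_eqF.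
Qed.

End scaling.

(** * Homotheties and integrability over cones *)

Section homothety_integral.
Variables (R : realType) (n : nat) (s : R) (c : 'rV[R]_n) (D : set 'rV[R]_n).
Hypotheses (s0 : 0 < s) (mD : measurable D).
Local Notation mu := (@lebesgue_rV R n).
Local Notation phi := (rV_homothety s c).

Lemma ge0_integral_homothety (f : 'rV[R]_n -> \bar R) :
  measurable_fun D f -> (forall x, D x -> (0 <= f x)%E) ->
  (\int[mu]_(x in phi @^-1` D) f (phi x) =
   (s ^- n)%:E * \int[mu]_(x in D) f x)%E.
Proof.
move=> mf f0.
have sn0 : 0 <= s ^- n by rewrite invr_ge0 exprn_ge0// ltW.
rewrite -(ge0_integral_mscale mu mD (NngNum sn0) mf f0).
rewrite -(ge0_integral_pushforward (measurable_rV_homothety s c) mu mD mf); last first.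
  by move=> x; rewrite inE => /f0.
apply: (eq_measure_integral
  (measure_function_mscale__canonical__measure_function_Measure (NngNum sn0) mu)
  (m1 := measure_function_pushforward__canonical__measure_function_Measure mu
    (measurable_rV_homothety s c))) => A mA _.
exact: (lebesgue_rV_homothety c s0 mA).
Qed.

Lemma Rintegral_homothety (f : 'rV[R]_n -> R) : mu.-integrable D (EFin \o f) ->
  \int[mu]_(x in phi @^-1` D) f (phi x) = s ^- n * \int[mu]_(x in D) f x.
Proof.
move=> intf; have mf := measurable_int _ intf.
rewrite /Rintegral (integralE _ _ (fun x => (f (phi x))%:E)).
rewrite (integralE _ _ (EFin \o f)).
have -> : (\int[mu]_(x in phi @^-1` D) (fun x => (f (phi x))%:E)^\+ x =
    (s ^- n)%:E * \int[mu]_(x in D) (EFin \o f)^\+ x)%E.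
  rewrite -(ge0_integral_homothety (measurable_funepos mf)) => [|x _].
    by apply: eq_integral => x _; rewrite !funeposE.
  exact: funepos_ge0.
have -> : (\int[mu]_(x in phi @^-1` D) (fun x => (f (phi x))%:E)^\- x =
    (s ^- n)%:E * \int[mu]_(x in D) (EFin \o f)^\- x)%E.
  rewrite -(ge0_integral_homothety (measurable_funeneg mf)) => [|x _].
    by apply: eq_integral => x _; rewrite !funenegE.
  exact: funeneg_ge0.
have p := integrable_pos_fin_num mD intf; have q := integrable_neg_fin_num mD intf.
by rewrite -(fineK p) -(fineK q) -!EFinM -!EFinB /= mulrBr.
Qed.

Lemma cint_homothety (g : 'rV[R]_n -> R[i]) : cintegrable mu D g ->
  cint mu (phi @^-1` D) (fun x => g (phi x)) = (s ^- n)%:C * cint mu D g.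
Proof.
move=> [g1 g2]; rewrite /cint.
rewrite (Rintegral_homothety (f := fun x => complex.Re (g x)) g1).
rewrite (Rintegral_homothety (f := fun x => complex.Im (g x)) g2).
by simpc.
Qed.

End homothety_integral.

Section cone.
Variables (R : realType) (n : nat) (K : set 'rV[R]_n) (V : 'rV[R]_n).
Variables (a : 'rV[R]_n -> R) (delta : R).
Local Notation mu := (@lebesgue_rV R n).
Local Notation dil s := (rV_homothety s ((1 - s) *: V)).
Hypotheses (mK : measurable K) (ma : measurable_fun setT a).
Hypothesis a_dil : forall s x, a (dil s x) = s * a x.
Hypothesis K_dil : forall s, 0 < s -> dil s @^-1` K = K.
Hypothesis a_ge0 : forall x, K x -> 0 <= a x.
Hypotheses (delta0 : 0 < delta).
Hypothesis trunc_fin : (mu (K `&` [set x | (a x <= delta)%R]) < +oo)%E.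

Let trunc r := K `&` [set x | a x <= r].

Let mtrunc r : measurable (trunc r).
Proof.
apply: measurableI => //.
have := ma measurableT (measurable_itv `]-oo, r]); rewrite setTI.
by congr measurable; apply/seteqP; split=> x; rewrite /= in_itv.
Qed.

Let trunc_dil s r : 0 < s -> dil s @^-1` trunc (s * r) = trunc r.
Proof.
move=> s0; rewrite /trunc preimage_setI K_dil//; congr (_ `&` _).
by apply/seteqP; split=> x /=; rewrite a_dil ler_pM2l.
Qed.

Let trunc_lty r : 0 < r -> (mu (trunc r) < +oo)%E.
Proof.
move=> r0; have dr : 0 < delta / r by rewrite divr_gt0.
rewrite -(trunc_dil r dr) divfK ?gt_eqF// lebesgue_rV_homothety//.
by apply: lte_mul_pinfty => //; rewrite ?lee_fin ?invr_ge0 ?exprn_ge0// ltW.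
Qed.

Let mexp (k : R) D : measurable_fun D (fun x => (expR (- (a x * k)))%:E).
Proof.
apply/measurable_EFinP; apply: measurable_funTS.
apply: (measurableT_comp (@measurable_expR R)).
by apply: measurableT_comp => //; exact: measurable_funM.
Qed.

(** Dilating by 2 turns exp (- a / 2) into exp (- a), which is at most
    2 ^- n.+1 times exp (- a / 2) outside of a truncation of finite measure:
    the integral over the truncation at 2 r is therefore bounded by a constant
    plus half of the integral over the truncation at r, so the integrals over the
    truncations at 2 ^+ k are bounded. *)
Lemma integrable_exp_cone : mu.-integrable K (fun x => (expR (- (a x / 2)))%:E).
Proof.
pose J (r : R) : \bar R := (\int[mu]_(x in trunc r) (expR (- (a x / 2)))%:E)%E.
pose t : R := (n.+1)%:R *+ 2.
have t0 : 0 < t by rewrite pmulrn_lgt0.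
(* Beyond height t, passing from exp (- a / 2) to exp (- a) gains 2 ^- n.+1. *)
have et : expR (- (t / 2)) <= 2 ^- n.+1.
  rewrite /t -mulr_natr mulfK// -[n.+1%:R]mul1r expRN expRM_natr.
  rewrite lef_pV2 ?posrE ?exprn_gt0 ?expR_gt0//.
  by rewrite lerXn2r ?nnegrE ?expR_ge0//; exact: (expR_ge1Dx 1).
pose c := fine (mu (trunc t)); pose M := Num.max (2 ^+ n.+1 * c) (fine (mu (trunc 1))).
have muc : mu (trunc t) = c%:E by rewrite fineK// ge0_fin_numE// trunc_lty.
have M0 : 0 <= M by rewrite le_max [X in _ || X]fine_ge0// orbT.
have JM k : (J (2 ^+ k)%R <= M%:E)%E.
  elim: k => [|k IHk].
    rewrite expr0.
    apply: (@le_trans _ _ (\int[mu]_(x in trunc 1%R) (cst 1 x))%E).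
      apply: ge0_le_integral => //.
      by move=> x [Kx _]; rewrite lee_fin expR_le1 oppr_le0 divr_ge0// a_ge0.
    rewrite integral_cst// mul1e -[leLHS]fineK ?lee_fin.
      by rewrite le_max lexx orbT.
    by rewrite ge0_fin_numE// trunc_lty.
  have step : (J (2 ^+ k.+1)%R = (2 ^+ n)%:E *
      \int[mu]_(x in trunc (2 ^+ k)%R) (expR (- (a x)))%:E)%E.
    have e := @ge0_integral_homothety R n 2 ((1 - 2) *: V) (trunc (2 ^+ k.+1)%R)
      ltac:(done) (mtrunc _) (fun x => (expR (- (a x / 2)))%:E) (@mexp _ _)
      (fun x _ => ltac:(rewrite lee_fin; exact: expR_ge0)).
    move: e; rewrite exprS trunc_dil// => e.
    have -> : (\int[mu]_(x in trunc (2 ^+ k)%R) (expR (- a x))%:E =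
        \int[mu]_(x in trunc (2 ^+ k)%R) (expR (- (a (dil 2 x) / 2)))%:E)%E.
      by apply: eq_integral => x _; rewrite a_dil mulrAC divff// mul1r.
    by rewrite e muleA -EFinM divff ?mul1e// expf_neq0.
  rewrite step.
  apply: (@le_trans _ _ ((2 ^+ n)%:E * ((2 ^- n.+1)%:E * J (2 ^+ k)%R + c%:E))%E).
    apply: lee_wpmul2l; first by rewrite lee_fin exprn_ge0.
    apply: (@le_trans _ _ (\int[mu]_(x in trunc (2 ^+ k)%R)
        ((2 ^- n.+1)%:E * (expR (- (a x / 2)))%:E + (\1_(trunc t) x)%:E))%E).
      apply: ge0_le_integral => //.
      - by have := @mexp 1 (trunc (2 ^+ k)); under eq_fun do rewrite mulr1.
      - apply: emeasurable_funD; last exact/measurable_EFinP.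
        by apply: emeasurable_funM => //; exact: mexp.
      move=> x [Kx _]; rewrite -EFinM -EFinD lee_fin.
      have [ta|at_] := ltP t (a x).
        apply: (@le_trans _ _ (2 ^- n.+1 * expR (- (a x / 2)))); last first.
          by rewrite lerDl.
        rewrite [in leLHS](_ : - a x = - (a x / 2) + - (a x / 2)); last by field.
        rewrite expRD ler_wpM2r ?expR_ge0//; apply: le_trans et.
        by rewrite ler_expR; lra.
      rewrite indicE mem_set/=; last by split.
      apply: (@le_trans _ _ 1); last by rewrite lerDr mulr_ge0 ?expR_ge0 ?invr_ge0 ?exprn_ge0.
      by rewrite expR_le1 oppr_le0 a_ge0.
    rewrite ge0_integralD//; last 2 first.
    - by apply: emeasurable_funM => //; exact: mexp.
    - exact/measurable_EFinP.
    rewrite ge0_integralZl_EFin//.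
    rewrite integral_indic// leeD2l// -muc le_measure ?inE//.
    exact: measurableI.
  apply: (@le_trans _ _ ((2 ^+ n)%:E * ((2 ^- n.+1)%:E * M%:E + c%:E))%E).
    apply: lee_wpmul2l; first by rewrite lee_fin exprn_ge0.
    by rewrite leeD2r// lee_wpmul2l// lee_fin invr_ge0 exprn_ge0.
  rewrite -EFinM lee_fin mulrDr mulrA.
  have -> : 2 ^+ n / 2 ^+ n.+1 = 2^-1 :> R.
    by rewrite exprS invfM mulrCA divff ?mulr1// expf_neq0.
  have : 2 ^+ n.+1 * c <= M by rewrite le_max lexx.
  rewrite exprS; lra.
have KE : K = \bigcup_k trunc (2 ^+ k)%R.
  apply/seteqP; split => [x Kx|x [k _ []//]].
  exists (Num.truncn (a x)).+1 => //; split => //=.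
  apply: (@le_trans _ _ (Num.truncn (a x)).+1%:R); first exact/ltW/truncnS_gt.
  by rewrite -natrX ler_nat ltnW// ltn_expl.
apply/integrableP; split; first exact: mexp.
apply: (@le_lt_trans _ _ M%:E); last exact: ltry.
under eq_integral do rewrite gee0_abs ?lee_fin ?expR_ge0//.
rewrite KE.
have cv := @ge0_nondecreasing_set_cvg_integral _ _ R (fun k => trunc (2 ^+ k)%R)
  (fun x => (expR (- (a x / 2)))%:E) mu.
have {}cv := cv _ (fun k => mtrunc _) (fun k => @mexp _ _) _.
have nd : {homo (fun k => trunc (2 ^+ k)%R) : p q / (p <= q)%N >-> (p <= q)%O}.
  move=> p q pq; apply/subsetPset => x [Kx /= ax]; split => //=.
  by apply: le_trans ax _; rewrite ler_weXn2l// ler1n.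
have {}cv := cv nd (fun k x _ => ltac:(rewrite lee_fin; exact: expR_ge0)).
rewrite -(cvg_lim _ cv)//; apply: lime_le; first by apply/cvg_ex; eexists; exact: cv.
exact: nearW.
Qed.

End cone.

(** * The transform of a set that agrees with a cone near its apex *)

Lemma cint_setU d (T : measurableType d) (R : realType)
    (mu : {measure set T -> \bar R}) (A B : set T) (f : T -> R[i]) :
  measurable A -> measurable B -> [disjoint A & B]%classic ->
  cintegrable mu (A `|` B) f ->
  cint mu (A `|` B) f = cint mu A f + cint mu B f.
Proof.
by move=> mA mB AB [f1 f2]; rewrite /cint !Rintegral_setU.
Qed.

Section cone_transform.
Variables (R : realType) (n : nat) (P K : set 'rV[R]_n) (V : 'rV[R]_n).
Variables (zeta : 'rV[R]_n -> R[i]) (C delta M : R).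
Local Notation mu := (@lebesgue_rV R n).
Local Notation dil s := (rV_homothety s ((1 - s) *: V)).
Hypotheses (mP : measurable P) (mK : measurable K) (PK : P `<=` K).
Hypothesis mzeta : cmeasurable setT zeta.
Hypothesis zeta_dil : forall s x, zeta (dil s x) = s%:C * zeta x.
Hypothesis K_dil : forall s, 0 < s -> dil s @^-1` K = K.
Hypotheses (C0 : 0 < C) (delta0 : 0 < delta).
Hypothesis zetaC : forall x, K x -> normc (zeta x) <= C * complex.Re (zeta x).
Hypothesis Ptrunc : forall x, K x -> complex.Re (zeta x) <= delta -> P x.
Hypothesis PM : forall x, P x -> complex.Re (zeta x) <= M.
Hypotheses (Pfin : (mu P < +oo)%E) (Ppos : (0 < mu P)%E).

Let a x := complex.Re (zeta x).

Let ma : measurable_fun setT a.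
Proof. by case: mzeta. Qed.

Let a_dil s x : a (dil s x) = s * a x.
Proof. by rewrite /a zeta_dil complexReM/= mul0r subr0. Qed.

Let a_ge0 x : K x -> 0 <= a x.
Proof. by move=> Kx; have := le_trans (normc_ge0 _) (zetaC Kx); rewrite pmulr_rge0. Qed.

Let mtrunc : measurable (K `&` [set x | a x <= delta]).
Proof.
apply: measurableI => //.
have := ma measurableT (measurable_itv `]-oo, delta]); rewrite setTI.
by congr measurable; apply/seteqP; split=> x; rewrite /= in_itv.
Qed.

Let expK : mu.-integrable K (fun x => (expR (- (a x / 2)))%:E).
Proof.
apply: (integrable_exp_cone mK ma a_dil K_dil a_ge0 delta0).
apply: le_lt_trans Pfin; apply: le_measure; rewrite ?inE//.
by move=> x [Kx ax]; exact: Ptrunc.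
Qed.

Let mzK : cmeasurable K zeta.
Proof. by case: mzeta => m1 m2; split; exact: measurable_funTS. Qed.

Let mweight (s : R) (w : R[i]) D :
  cmeasurable D (fun x => cexp (- (s%:C * conjc (zeta x)) - w * zeta x)).
Proof.
have mD : cmeasurable D zeta.
  by case: mzeta => m1 m2; split; exact: measurable_funTS.
apply: cmeasurable_cexp; apply: cmeasurableD; apply: cmeasurableN.
  by apply: cmeasurableM; [exact: cmeasurable_cst|exact: cmeasurable_conj].
by apply: cmeasurableM => //; exact: cmeasurable_cst.
Qed.

Let mKP : measurable (K `\` P).
Proof. exact: measurableD. Qed.

Let tail_bound s B x : 1 <= s -> normc B * C / s <= s / 4 -> (K `\` P) x ->
  normc (cexp (- (s%:C * conjc (zeta x)) - (B / s%:C) * zeta x)) <=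
  expR (- (s * delta / 4)) * expR (- (a x / 2)).
Proof.
move=> s1 sB [Kx nPx]; have s0 : 0 < s by exact: lt_le_trans s1.
have ad : delta < a x by rewrite ltNge; apply/negP => /(Ptrunc Kx).
rewrite normc_cexp -expRD ler_expR complexReD.
have -> : complex.Re (- (s%:C * conjc (zeta x))) = - (s * a x).
  by rewrite /a; case: (zeta x) => p q /=; simpc.
have hz : complex.Re (- (B / s%:C * zeta x)) <= s / 4 * a x.
  apply: le_trans (ler_norm _) _; apply: le_trans (Re_le_normc _) _.
  rewrite normcN !ComplexField.Normc.normcM ComplexField.Normc.normcV.
  rewrite normc_real gtr0_norm//.
  apply: (@le_trans _ _ (normc B / s * (C * a x))).
    by rewrite ler_wpM2l ?zetaC// divr_ge0 ?normc_ge0// ltW.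
  rewrite (_ : _ * (C * a x) = normc B * C / s * a x); last by ring.
  by rewrite ler_wpM2r// a_ge0.
have : 0 <= (s - 1) * (a x - delta) by rewrite mulr_ge0 ?subr_ge0// ltW.
have : 0 <= (s - 1) * delta by rewrite mulr_ge0 ?subr_ge0// ltW.
have := a_ge0 Kx; move: hz; move: (complex.Re _) => r.
by nra.
Qed.

Let integrable_weight (s : R) (w : R[i]) : normc w * C <= s - 2^-1 ->
  cintegrable mu K (fun x => cexp (- (s%:C * conjc (zeta x)) - w * zeta x)).
Proof.
move=> w2; apply: (cintegrable_le mK (@mweight s w K)
  (G := fun x => expR (- (a x / 2))) expK) => x Kx.
rewrite normc_cexp ler_expR complexReD.
have -> : complex.Re (- (s%:C * conjc (zeta x))) = - (s * a x).
  by rewrite /a; case: (zeta x) => p q /=; simpc.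
have hz : complex.Re (- (w * zeta x)) <= (s - 2^-1) * a x.
  apply: le_trans (ler_norm _) _; apply: le_trans (Re_le_normc _) _.
  rewrite normcN !ComplexField.Normc.normcM.
  apply: (@le_trans _ _ (normc w * (C * a x))).
    by rewrite ler_wpM2l ?zetaC ?normc_ge0.
  by rewrite mulrA ler_wpM2r// a_ge0.
move: hz; move: (complex.Re _) => r; lra.
Qed.

Let integrable_small (w : R[i]) : normc w * C <= 2^-1 ->
  cintegrable mu K (fun x => zeta x ^+ 0 * cexp (- conjc (zeta x) - w * zeta x)).
Proof.
move=> w2; have w1 : normc w * C <= 1 - 2^-1 by lra.
have := integrable_weight w1; congr cintegrable.
by apply/funext => x; rewrite expr0 !mul1r.
Qed.

Let scaled s (B : R[i]) : 0 < s -> normc (B * (s ^- 2)%:C) * C <= 2^-1 ->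
  (s ^- n)%:C * cone_moment mu K zeta (B * (s ^- 2)%:C) 0 =
  cint mu K (fun x => cexp (- (s%:C * conjc (zeta x)) - (B / s%:C) * zeta x)).
Proof.
move=> s0 small.
rewrite /cone_moment -(cint_homothety ((1 - s) *: V) s0 mK (integrable_small small)).
rewrite K_dil//; apply: eq_cint => x Kx.
rewrite expr0 mul1r zeta_dil conjcZr; congr (cexp (_ - _)).
rewrite mulrA; congr (_ * _); rewrite -mulrA; congr (_ * _).
have sC : s%:C != 0 :> R[i] by rewrite -normc_eq0 normc_real normr_eq0 gt_eqF.
by rewrite fmorphV rmorphXn; field.
Qed.

(** With v = s ^- 2, the moment at B * v is the dilation by s of the integral with
    phases s and B / s. That integral vanishes on P, and what remains lies at
    heights above delta, where it is exponentially small in s. *)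
Lemma cone_moment_flat (B : R[i]) :
  (forall s, 0 < s ->
    cint mu P (fun x => cexp (- (s%:C * conjc (zeta x)) - (B / s%:C) * zeta x)) = 0) ->
  forall k, exists c v0 : R, 0 < v0 /\ forall v, 0 < v -> v <= v0 ->
    normc (cone_moment mu K zeta (B * v%:C) 0) <= c * v ^+ k.
Proof.
move=> vanish k; have nB := normc_ge0 B.
pose I := \int[mu]_(x in K `\` P) expR (- (a x / 2)).
have I0 : 0 <= I by apply: Rintegral_ge0 => x _; exact: expR_ge0.
(* exp (- c s) <= const * s ^- m absorbs the Jacobian s ^+ n and leaves v ^+ k. *)
pose m := (n + k.*2)%N.
exists (2 * (m`!%:R * (4 / delta) ^+ m * I)).
pose v0 := Num.min 1 (4 * (normc B * C + 1))^-1; exists v0.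
have BC0 : 0 <= normc B * C by rewrite mulr_ge0// ltW.
have v00 : 0 < v0 by rewrite lt_min ltr01 invr_gt0 mulr_gt0// ltr_wpDl.
split => // v vp vv0; pose s := (Num.sqrt v)^-1.
have sv : 0 < Num.sqrt v by rewrite sqrtr_gt0.
have s0 : 0 < s by rewrite invr_gt0.
have s2 : s ^- 2 = v by rewrite /s exprVn invrK sqr_sqrtr// ltW.
have s1 : 1 <= s.
  rewrite invf_ge1// -sqrtr1 ler_wsqrtr//.
  by move: vv0; rewrite le_min => /andP[].
have vB : normc B * C * v <= 4^-1.
  have : v * (4 * (normc B * C + 1)) <= 1.
    by rewrite -ler_pdivlMr ?mulr_gt0 ?ltr_wpDl// div1r;
      move: vv0; rewrite le_min => /andP[].
  lra.
have sB : normc B * C / s <= s / 4.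
  have -> : normc B * C / s = normc B * C * v * s.
    by rewrite -s2; field; rewrite gt_eqF.
  by rewrite [leRHS]mulrC ler_wpM2r// ltW.
have small : normc (B * (s ^- 2)%:C) * C <= 2^-1.
  rewrite s2 ComplexField.Normc.normcM normc_real gtr0_norm// mulrAC.
  apply: le_trans vB _; lra.
have := scaled s0 small; rewrite s2.
have KE : K = P `|` (K `\` P) by rewrite setDUK.
have iK' : cintegrable mu K
    (fun x => cexp (- (s%:C * conjc (zeta x)) - (B / s%:C) * zeta x)).
  by apply: integrable_weight; rewrite ComplexField.Normc.normcM ComplexField.Normc.normcV normc_real gtr0_norm// mulrAC; lra.
rewrite {2}KE cint_setU//; last 2 first.
- by apply/disj_setPS => x [Px [_ /(_ Px)]].
- by rewrite -KE.
rewrite vanish// add0r => e.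
have -> : cone_moment mu K zeta (B * v%:C) 0 = (s ^+ n)%:C *
    cint mu (K `\` P)
      (fun x => cexp (- (s%:C * conjc (zeta x)) - (B / s%:C) * zeta x)).
  by rewrite -e mulrA -rmorphM divff ?rmorph1 ?mul1r// expf_neq0// gt_eqF.
rewrite ComplexField.Normc.normcM normc_real ger0_norm ?exprn_ge0 ?(ltW s0)//.
have expKP : mu.-integrable (K `\` P) (EFin \o (fun x => expR (- (a x / 2)))).
  by apply: (integrableS mK mKP _ expK); exact: subDsetl.
have := normc_cint_le mKP (@mweight s (B / s%:C) _)
  (integrableZl_EFin mKP (expR (- (s * delta / 4))) expKP)
  (fun x => @tail_bound s B x s1 sB).
rewrite RintegralZl// -/I => h.
apply: (@le_trans _ _ (s ^+ n * (2 * (expR (- (s * delta / 4)) * I)))).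
  by rewrite ler_wpM2l// exprn_ge0// ltW.
have sd : 0 < s * delta / 4 by rewrite divr_gt0// mulr_gt0.
have he : expR (- (s * delta / 4)) <= m`!%:R * (s * delta / 4) ^- m.
  rewrite expRN -[leRHS]invrK invfM invrK lef_pV2 ?posrE ?expR_gt0//; last first.
    by rewrite mulr_gt0 ?invr_gt0 ?exprn_gt0// ltr0n fact_gt0.
  by rewrite mulrC; apply: exp_term_le; exact: ltW.
apply: (@le_trans _ _ (s ^+ n * (2 * (m`!%:R * (s * delta / 4) ^- m * I)))).
  by rewrite ler_wpM2l ?exprn_ge0 ?(ltW s0)// ler_wpM2l// ler_wpM2r.
have -> : v ^+ k = s ^+ n * s ^- m.
  rewrite -s2 -!exprVn -exprM mul2n /m exprD mulrA -exprMn divff ?gt_eqF//.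
  by rewrite expr1n mul1r.
rewrite le_eqVlt; apply/orP; left; apply/eqP.
rewrite -[_ ^- m]exprVn -[s ^- m]exprVn.
have -> : (s * delta / 4)^-1 = s^-1 * (4 / delta).
  by field; rewrite !gt_eqF.
by rewrite exprMn; ring.
Qed.

(** The flat cone transform vanishes identically, although for real parameters
    it is the integral of a positive function. *)
Lemma cone_transform_neq0 (B : R[i]) : B != 0 ->
  ~ (forall s, 0 < s ->
    cint mu P (fun x => cexp (- (s%:C * conjc (zeta x)) - (B / s%:C) * zeta x)) = 0).
Proof.
move=> B0 vanish.
have flat := cone_moment_flat vanish.
have m0 := cone_moments_eq0_of_flat mK mzK C0 zetaC expK B0 flat.
have m1 := cone_moments_continue mK mzK C0 zetaC expK m0.
have fE x : complex.Re (zeta x ^+ 0 * cexp (- conjc (zeta x) - 1 * zeta x)) =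
    expR (- (2 * a x)).
  rewrite expr0 mul1r mul1r /a; case: (zeta x) => p q; rewrite /cexp/=.
  have -> : - - q - q = 0 by ring.
  by rewrite cos0 sin0; simpc; rewrite /=; congr expR; ring.
have I0 : \int[mu]_(x in K) expR (- (2 * a x)) = 0.
  transitivity (complex.Re (cone_moment mu K zeta 1 0)); last by rewrite m1.
  by apply: eq_Rintegral => x _; rewrite fE.
have iK : mu.-integrable K (EFin \o (fun x => expR (- (2 * a x)))).
  apply: (le_integrable mK _ _ expK).
    apply/measurable_EFinP/measurable_funTS.
    apply: (measurableT_comp (@measurable_expR R)).
    by apply: measurableT_comp => //; exact: measurable_funM.
  move=> x Kx; rewrite /= lee_fin !ger0_norm ?expR_ge0// ler_expR.
  have := a_ge0 Kx; lra.
have : expR (- (2 * M)) * fine (mu P) <= 0.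
  rewrite -I0; have KE : K = P `|` (K `\` P) by rewrite setDUK.
  rewrite [X in \int[mu]_(x in X) _]KE Rintegral_setU//; last 2 first.
  - by rewrite -KE.
  - by apply/disj_setPS => x [Px [_ /(_ Px)]].
  rewrite -[leLHS]addr0; apply: lerD; last first.
    by apply: Rintegral_ge0 => x _; exact: expR_ge0.
  rewrite -(Rintegral_cst mu mP); apply: le_Rintegral => //.
  - exact: integrable_cst_set.
  - exact: (integrableS mK mP PK iK).
  by move=> x Px; rewrite ler_expR lerN2 ler_wpM2l// PM.
by rewrite leNgt mulr_gt0 ?expR_gt0// fine_gt0// Ppos Pfin.
Qed.

End cone_transform.

(** * Convex hulls of finite families *)

Section dot_product.
Variables (R : comPzRingType) (n : nat).
Implicit Types (x y : 'rV[R]_n).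

Lemma dotvC x y : dotv x y = dotv y x.
Proof. by apply: eq_bigr => i _; rewrite mulrC. Qed.

Lemma dotvDr x y z : dotv x (y + z) = dotv x y + dotv x z.
Proof. by rewrite -big_split/=; apply: eq_bigr => i _; rewrite mxE mulrDr. Qed.

Lemma dotvZr x (k : R) y : dotv x (k *: y) = k * dotv x y.
Proof. by rewrite mulr_sumr; apply: eq_bigr => i _; rewrite mxE mulrCA. Qed.

Lemma dotvNr x y : dotv x (- y) = - dotv x y.
Proof. by rewrite -scaleN1r dotvZr mulN1r. Qed.

Lemma dotvBr x y z : dotv x (y - z) = dotv x y - dotv x z.
Proof. by rewrite dotvDr dotvNr. Qed.

Lemma dotv0r x : dotv x 0 = 0.
Proof. by rewrite -[0](scale0r 0) dotvZr mul0r. Qed.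

Lemma dotvDl x y z : dotv (x + y) z = dotv x z + dotv y z.
Proof. by rewrite !(dotvC _ z) dotvDr. Qed.

Lemma dotvZl (k : R) x y : dotv (k *: x) y = k * dotv x y.
Proof. by rewrite !(dotvC _ y) dotvZr. Qed.

Lemma dotvNl x y : dotv (- x) y = - dotv x y.
Proof. by rewrite !(dotvC _ y) dotvNr. Qed.

Lemma dotvBl x y z : dotv (x - y) z = dotv x z - dotv y z.
Proof. by rewrite !(dotvC _ z) dotvBr. Qed.

Lemma dotv_sumr (I : Type) (s : seq I) (P : pred I) x (F : I -> 'rV[R]_n) :
  dotv x (\sum_(i <- s | P i) F i) = \sum_(i <- s | P i) dotv x (F i).
Proof. exact: (big_morph _ (dotvDr x) (dotv0r x)). Qed.

End dot_product.

Section genericity.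
Variable R : realFieldType.

Lemma common_nonroot (s : seq {poly R}) :
  {in s, forall p, p != 0} -> exists t, {in s, forall p, p.[t] != 0}.
Proof.
move=> s0; pose P := \prod_(p <- s) p.
have P0 : P != 0 by rewrite prodf_seq_neq0; apply/allP => p /s0 ->.
pose r := [seq i%:R : R | i <- iota 0 (size P)].
have ur : uniq r.
  by rewrite map_inj_uniq ?iota_uniq// => i j /eqP; rewrite eqr_nat => /eqP.
have : ~~ all (root P) r.
  apply/negP => /(max_poly_roots P0) /(_ ur).
  by rewrite size_map size_iota ltnn.
case/allPn => t _ Pt; exists t => p ps.
apply: contra Pt => pt; rewrite rootE horner_prod.
by rewrite (big_rem _ ps)/= (eqP pt) mul0r.
Qed.

(** The moment curve (1, t, t ^+ 2, ...) meets each of finitely many hyperplanes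
    through the origin in finitely many points. *)
Lemma generic_functional n (s : seq 'rV[R]_n) :
  {in s, forall w, w != 0} -> exists c, {in s, forall w, dotv c w != 0}.
Proof.
move=> s0.
have [|t ht] := @common_nonroot [seq rVpoly w | w <- s].
  move=> _ /mapP[w ws ->]; apply: contra (s0 w ws) => /eqP w0.
  by apply/eqP; rewrite -[w]rVpolyK w0 linear0.
exists (\row_i t ^+ i) => w ws.
suff -> : dotv (\row_i t ^+ i) w = (rVpoly w).[t] by apply/ht/map_f.
rewrite (horner_coef_wide _ (size_poly _ _)); apply: eq_bigr => i _.
by rewrite mxE coef_rVpoly_ord mulrC.
Qed.

(** A linear form that vanishes at e + t f for infinitely many t vanishes at e and
    at f. *)
Lemma generic_pencil n (e f : 'rV[R]_n) (s : seq 'rV[R]_n) :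
  exists t, {in s, forall w,
    dotv (e + t *: f) w = 0 -> dotv e w = 0 /\ dotv f w = 0}.
Proof.
pose pol w := (dotv e w)%:P + (dotv f w) *: 'X.
have [|t ht] := @common_nonroot [seq p <- [seq pol w | w <- s] | p != 0].
  by move=> p; rewrite mem_filter => /andP[].
exists t => w ws; rewrite dotvDl dotvZl => h0.
have [p0|p0] := eqVneq (pol w) 0.
  have c0 := congr1 (fun p : {poly R} => p`_0) p0.
  have c1 := congr1 (fun p : {poly R} => p`_1) p0.
  by move: c0 c1; rewrite /= !coefE/= mulr0 addr0 mulr1 add0r.
have := ht (pol w); rewrite mem_filter p0 map_f// => /(_ isT).
by rewrite /pol hornerD hornerC hornerZ hornerX [_ * t]mulrC h0 eqxx.
Qed.

End genericity.

Section convex_hull_combination.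
Variables (R : realType) (d m : nat) (q : 'I_m -> 'rV[R]_d).

Definition weights (l : 'I_m -> R) := (forall i, 0 <= l i) /\ \sum_i l i = 1.

Definition combination (l : 'I_m -> R) : 'rV[R]_d := \sum_i l i *: q i.

Lemma convex_combination (M : set 'rV[R]_d) (x y : 'rV[R]_d) (t : R) :
  @convex_set R (convex_lmodType 'rV[R]_d) M -> M x -> M y -> 0 <= t -> t <= 1 ->
  M (t *: x + (1 - t) *: y).
Proof.
move=> cM Mx My t0 t1.
have := cM x y (Itv01 t0 t1); rewrite !inE => /(_ Mx My).
by [].
Qed.

Lemma convex_set_combination (M : set 'rV[R]_d) :
  @convex_set R (convex_lmodType 'rV[R]_d) M ->
  (forall i, M (q i)) -> forall l, weights l -> M (combination l).
Proof.
move=> cM Mq l [l0]; rewrite /combination.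
elim: (index_enum _) l l0 => [|i s IHs] l l0.
  by rewrite big_nil => /eqP; rewrite eq_sym oner_eq0.
rewrite !big_cons => l1; set S := \sum_(j <- s) l j.
have S0 : 0 <= S by exact: sumr_ge0.
have [Seq0|Sn0] := eqVneq S 0.
  rewrite [X in _ + X]big1_seq ?addr0.
    by move: l1; rewrite -/S Seq0 addr0 => ->; rewrite scale1r.
  move=> j /andP[_ js]; suff -> : l j = 0 by rewrite scale0r.
  apply/eqP; rewrite eq_le l0 andbT -Seq0 /S (big_rem _ js)/= lerDl.
  exact: sumr_ge0.
have Sp : 0 < S by rewrite lt_neqAle eq_sym Sn0.
have -> : \sum_(j <- s) l j *: q j = (1 - l i) *: (\sum_(j <- s) (l j / S) *: q j).
  rewrite -l1 addrC addKr -/S scaler_sumr; apply: eq_bigr => j _.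
  by rewrite scalerA mulrC divfK.
apply: convex_combination => //; last by move: l1; rewrite -/S => l1; lra.
apply: (IHs (fun j => l j / S)); first by move=> j; rewrite divr_ge0.
by rewrite -mulr_suml divff.
Qed.

Lemma convex_set_combinations :
  @convex_set R (convex_lmodType 'rV[R]_d) [set combination l | l in weights].
Proof.
move=> x y t; rewrite !inE => -[l [l0 l1] <-] [k [k0 k1] <-].
have r0 : 0 <= t%:num :> R by exact: ge0.
have r1 : t%:num <= 1 :> R by exact: le1.
move: r0 r1; set r := t%:num => r0 r1.
exists (fun i => r * l i + (1 - r) * k i).
  split; first by move=> i; rewrite addr_ge0// mulr_ge0// subr_ge0.
  by rewrite big_split/= -!mulr_sumr l1 k1; ring.
rewrite /combination; under eq_bigr do rewrite scalerDl -!scalerA.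
by rewrite big_split/= -!scaler_sumr.
Qed.

Lemma weights_vertex i : weights (fun j => (i == j)%:R).
Proof.
split=> [j|]; first by rewrite ler0n.
by rewrite (bigD1 i)//= eqxx big1 ?addr0// => j; rewrite eq_sym => /negPf ->.
Qed.

Lemma combination_vertex i : combination (fun j => (i == j)%:R) = q i.
Proof.
rewrite /combination (bigD1 i)//= eqxx scale1r big1 ?addr0// => j.
by rewrite eq_sym => /negPf ->; rewrite scale0r.
Qed.

Lemma convex_hullE :
  convex_hull (range q) = [set combination l | l in weights].
Proof.
apply/seteqP; split.
  apply: smallest_sub; first exact: convex_set_combinations.
  move=> _ [i _ <-]; exists (fun j => (i == j)%:R).
    exact: weights_vertex.
  exact: combination_vertex.
move=> _ [l wl <-] M [cM qM]; apply: convex_set_combination => // i.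
by apply: qM; exists i.
Qed.

Lemma dotv_combination (c : 'rV[R]_d) l :
  dotv c (combination l) = \sum_i l i * dotv c (q i).
Proof. by rewrite dotv_sumr; apply: eq_bigr => i _; rewrite dotvZr. Qed.

Lemma combinationB l (V : 'rV[R]_d) : weights l ->
  combination l - V = \sum_i l i *: (q i - V).
Proof.
move=> [_ l1]; rewrite -[V in LHS]scale1r -l1 scaler_suml -sumrB.
by apply: eq_bigr => i _; rewrite scalerBr.
Qed.

End convex_hull_combination.

(** * Exposed vertices *)

Section exposed_vertex.
Variables (R : realType) (d : nat).

Definition segment (V W : 'rV[R]_d) : set 'rV[R]_d :=
  [set V + k *: (W - V) | k in `[0, 1]].

Lemma convex_hull2E (V W : 'rV[R]_d) : convex_hull [set V; W] = segment V W.
Proof.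
apply/seteqP; split.
  apply: smallest_sub; last first.
    move=> _ [->|->]; first by exists 0; rewrite ?scale0r ?addr0// /= in_itv/= lexx ler01.
    exists 1; first by rewrite /= in_itv/= ler01 lexx.
    by rewrite scale1r addrC subrK.
  move=> x y t; rewrite !inE => -[k k01 <-] [l l01 <-].
  have r0 : 0 <= t%:num :> R by exact: ge0.
  have r1 : t%:num <= 1 :> R by exact: le1.
  move: r0 r1; set r := t%:num => r0 r1.
  exists (r * k + (1 - r) * l).
    move: k01 l01; rewrite /= !in_itv/= => /andP[k0 k1] /andP[l0 l1].
    by apply/andP; split; nra.
  change (V + (r * k + (1 - r) * l) *: (W - V) =
    r *: (V + k *: (W - V)) + (1 - r) *: (V + l *: (W - V))).
  by apply/rowP => i; rewrite !mxE; ring.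
move=> x [k /=]; rewrite in_itv/= => /andP[k0 k1] <- M [cM MVW].
have -> : V + k *: (W - V) = k *: W + (1 - k) *: V.
  by apply/rowP => i; rewrite !mxE; ring.
by apply: convex_combination => //; apply: MVW; [right|left].
Qed.

Variables (m : nat) (q : 'I_m -> 'rV[R]_d).
Let P := convex_hull (range q).

Lemma hull_vertex i : P (q i).
Proof. by move=> M [_ qM]; apply: qM; exists i. Qed.

(** The face on which h is minimal is spanned by the generators at which h is
    minimal; here they all lie on one segment. *)
Lemma edge_of_collinear (h : 'rV[R]_d) (i0 i1 : 'I_m) :
  q i1 != q i0 ->
  (forall j, 0 <= dotv h (q j - q i0)) -> dotv h (q i1 - q i0) = 0 ->
  (forall j, dotv h (q j - q i0) = 0 ->
    exists2 k, k \in `[0, 1] & q j - q i0 = k *: (q i1 - q i0)) ->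
  edge P (segment (q i0) (q i1)).
Proof.
set V := q i0; set W := q i1 => WV h_ge0 hW hj.
have hP y : P y -> dotv h V <= dotv h y.
  rewrite /P convex_hullE => -[l wl <-]; rewrite -subr_ge0 -dotvBr combinationB//.
  rewrite dotv_sumr sumr_ge0// => j _; rewrite dotvZr mulr_ge0//.
  by case: wl.
split.
  exists (- h); apply/seteqP; split => [_ [k k01 <-]|x [Px xmax]].
    split.
      move: (k01); rewrite /= in_itv/= => /andP[k0 k1].
      have : convex_hull [set V; W] (V + k *: (W - V)).
        by rewrite convex_hull2E; exists k.
      apply => //; split; first by rewrite /P convex_hullE; exact: convex_set_combinations.
      by move=> _ [->|->]; exact: hull_vertex.
    move=> y Py; rewrite !dotvNl lerN2 dotvDr dotvZr hW mulr0 addr0.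
    exact: hP.
  have hx : dotv h (x - V) = 0.
    apply/eqP; rewrite dotvBr subr_eq0 eq_le hP// andbT.
    by have := xmax _ (hull_vertex i0); rewrite !dotvNl lerN2.
  move: Px hx; rewrite /P convex_hullE => -[l [l0 l1] <-].
  rewrite combinationB// dotv_sumr => /eqP; rewrite psumr_eq0; last first.
    by move=> j _; rewrite dotvZr mulr_ge0.
  move=> /allP lh.
  have jk j : exists2 k, k \in `[0, 1] & l j *: (q j - V) = (l j * k) *: (W - V).
    have := lh j (mem_index_enum _); rewrite /= dotvZr mulf_eq0.
    have [->|_ /= /eqP] := eqVneq (l j) 0.
      by exists 0; rewrite ?mul0r ?scale0r// in_itv/= lexx ler01.
    by move=> /hj[k k01 ->]; exists k => //; rewrite scalerA.
  have [k kP] := choice (fun j => let: ex_intro2 k a b := jk j in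
    ex_intro (fun k => k \in `[0, 1] /\ l j *: (q j - V) = (l j * k) *: (W - V))
      k (conj a b)).
  exists (\sum_j l j * k j).
    rewrite /= in_itv/= sumr_ge0/=; last first.
      by move=> j _; have [] := kP j; rewrite in_itv/= => /andP[k0 _] _; rewrite mulr_ge0.
    rewrite -l1 ler_sum// => j _; have [] := kP j.
    by rewrite in_itv/= => /andP[_ k1] _; rewrite ler_piMr.
  apply/eqP; rewrite eq_sym addrC -subr_eq combinationB//; apply/eqP.
  by rewrite scaler_suml; apply: eq_bigr => j _; have [] := kP j.
exists V, <[W - V]>%VS; split.
- by exists 0; rewrite ?scale0r ?addr0// /= in_itv/= lexx ler01.
- move=> _ [k _ <-]; rewrite addrC addKr; exact: memvZ (memv_line _).
- move=> U UF; rewrite -memvE; apply: UF.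
  exists 1; first by rewrite /= in_itv/= ler01 lexx.
  by rewrite scale1r addrC subrK.
- by rewrite dim_vline subr_eq0 WV.
Qed.

(** Minimise on the generators a generic p = e + t f, and break ties with a generic
    functional c, which selects a vertex q i0. If the minimum of p were attained at
    another point, then tilting c until it becomes tight at one more tied generator
    would single out an edge issued from q i0 inside the face where p is minimal;
    by genericity of p that edge would be orthogonal to e and f. *)
Lemma exposed_vertex (H : {vspace 'rV[R]_d}) (e f : 'rV[R]_d) (j0 : 'I_m) :
  basis_of H [:: e; f] ->
  (forall F, edge P F -> ~ orthogonal_to_edge H F) ->
  exists t i0, forall i, q i = q i0 \/ 0 < dotv (e + t *: f) (q i - q i0).
Proof.
move=> Hef noedge.
pose D := [seq q i - q j | i <- enum 'I_m, j <- enum 'I_m].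
have inD i j : q i - q j \in D.
  by apply/allpairsP; exists (i, j); rewrite !mem_enum.
have [t ht] := generic_pencil e f D; pose p := e + t *: f.
have [|c hc] := @generic_functional R d [seq w <- D | w != 0].
  by move=> w; rewrite mem_filter => /andP[].
have [i1 _ pmin] := @arg_minP _ _ _ j0 xpredT (fun i => dotv p (q i)) isT.
have [i0 /eqP pi0 cmin] := @arg_minP _ _ _ i1
  (fun i => dotv p (q i) == dotv p (q i1)) (fun i => dotv c (q i)) (eqxx _).
pose D0 i := q i - q i0.
have p_ge0 i : 0 <= dotv p (D0 i) by rewrite dotvBr subr_ge0 pi0 pmin.
exists t, i0 => i; rewrite -/p -/(D0 i).
have [->|qi] := eqVneq (q i) (q i0); [by left|right].
rewrite lt_neqAle p_ge0 andbT eq_sym; apply/eqP => pi; exfalso.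
have Di : D0 i != 0 by rewrite subr_eq0.
pose flat j := (dotv p (D0 j) == 0) && (D0 j != 0).
have cpos j : flat j -> 0 < dotv c (D0 j).
  move=> /andP[pj Dj]; rewrite lt_neqAle eq_sym hc ?mem_filter ?Dj ?inD//=.
  by rewrite dotvBr subr_ge0 cmin// -pi0 -subr_eq0 -dotvBr.
pose cross j k := dotv c (D0 j) *: D0 k - dotv c (D0 k) *: D0 j.
have [|g hg] := @generic_functional R d
    [seq w <- [seq cross j k | j <- enum 'I_m, k <- enum 'I_m] | w != 0].
  by move=> w; rewrite mem_filter => /andP[].
have fi : flat i by rewrite /flat pi eqxx.
have [i2 f2 rmax] := @arg_maxP _ _ _ i flat
  (fun j => dotv g (D0 j) / dotv c (D0 j)) fi.
set T := _ / _ in rmax; have c2 := cpos _ f2.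
(* T is the largest ratio, so c' is nonnegative on the tied differences and vanishes
   at D0 i2. The genericity of g makes c' vanish only on multiples of D0 i2. *)
pose c' := T *: c - g.
have c'E j : dotv c' (D0 j) = T * dotv c (D0 j) - dotv g (D0 j).
  by rewrite dotvBl dotvZl.
have c'_ge0 j : flat j -> 0 <= dotv c' (D0 j).
  by move=> fj; rewrite c'E subr_ge0 -ler_pdivrMr ?cpos//; exact: rmax.
have c'2 : dotv c' (D0 i2) = 0.
  by rewrite c'E /T divfK ?subrr// gt_eqF.
have c'0 j : flat j -> dotv c' (D0 j) = 0 ->
    D0 j = (dotv c (D0 j) / dotv c (D0 i2)) *: D0 i2.
  move=> fj j0'; have [cr0|cr] := eqVneq (cross i2 j) 0.
    move: cr0 => /eqP; rewrite subr_eq0 => /eqP /(congr1 (fun w =>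
      (dotv c (D0 i2))^-1 *: w)).
    by rewrite !scalerA mulVf ?gt_eqF// scale1r [_ * dotv c (D0 j)]mulrC.
  have := hg (cross i2 j); rewrite mem_filter cr/= => /(_ _)/eqP[].
    by apply/allpairsP; exists (i2, j); rewrite !mem_enum.
  rewrite dotvBr !dotvZr.
  have -> : dotv g (D0 j) = T * dotv c (D0 j) by apply/esym/eqP; rewrite -subr_eq0 -c'E j0'.
  have -> : dotv g (D0 i2) = T * dotv c (D0 i2) by apply/esym/eqP; rewrite -subr_eq0 -c'E c'2.
  by ring.
(* The tied generators contribute 0 to the sum, since x / 0 = 0. *)
pose N := 1 + \sum_j `|dotv c' (D0 j)| / dotv p (D0 j).
pose h := N *: p + c'.
have hE j : dotv h (D0 j) = N * dotv p (D0 j) + dotv c' (D0 j).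
  by rewrite dotvDl dotvZl.
have h_pos j : dotv p (D0 j) != 0 -> 0 < dotv h (D0 j).
  move=> pj; have pj0 : 0 < dotv p (D0 j) by rewrite lt_neqAle eq_sym pj p_ge0.
  rewrite hE; apply: (@lt_le_trans _ _
    (N * dotv p (D0 j) - `|dotv c' (D0 j)|)); last first.
    by rewrite lerD2l lerNl -normrN ler_norm.
  rewrite subr_gt0 -ltr_pdivrMr//; apply: (@le_lt_trans _ _
    (\sum_j `|dotv c' (D0 j)| / dotv p (D0 j))); last by rewrite ltrDr ltr01.
  rewrite (bigD1 j)//= lerDl sumr_ge0// => k _; by rewrite divr_ge0.
have h_ge0 j : 0 <= dotv h (D0 j).
  have [pj|] := eqVneq (dotv p (D0 j)) 0; last by move=> /h_pos/ltW.
  rewrite hE pj mulr0 add0r.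
  have [->|Dj] := eqVneq (D0 j) 0; first by rewrite dotv0r.
  by apply: c'_ge0; rewrite /flat pj eqxx.
have h0 j : dotv h (D0 j) = 0 ->
    dotv p (D0 j) = 0 /\ D0 j = (dotv c (D0 j) / dotv c (D0 i2)) *: D0 i2.
  move=> hj; have pj : dotv p (D0 j) = 0.
    by apply/eqP; apply: contraT => /h_pos; rewrite hj ltxx.
  split=> //; have [->|Dj] := eqVneq (D0 j) 0; first by rewrite dotv0r mul0r scale0r.
  apply: c'0; first by rewrite /flat pj eqxx.
  by rewrite -hj hE pj mulr0 add0r.
have h2 : dotv h (D0 i2) == 0.
  by rewrite hE c'2 addr0; case/andP: f2 => /eqP -> _; rewrite mulr0.
(* The other end of the edge is its point farthest from q i0. *)
have [i3 /eqP h3 cmax] := @arg_maxP _ _ _ i2 (fun j => dotv h (D0 j) == 0)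
  (fun j => dotv c (D0 j)) h2.
have c3 : 0 < dotv c (D0 i3) by apply: lt_le_trans c2 _; exact: cmax.
have [p3 D3] := h0 _ h3.
have c_ge0 j : dotv h (D0 j) = 0 -> 0 <= dotv c (D0 j).
  move=> /h0[pj _]; have [->|Dj] := eqVneq (D0 j) 0; first by rewrite dotv0r.
  by apply/ltW/cpos; rewrite /flat pj eqxx.
apply: (noedge (segment (q i0) (q i3))).
  apply: (@edge_of_collinear h) => //.
    by apply: contraTneq c3 => q3; rewrite /D0 q3 subrr dotv0r ltxx.
  move=> j hj; exists (dotv c (D0 j) / dotv c (D0 i3)).
    rewrite in_itv/= divr_ge0 ?c_ge0 ?(ltW c3)//= ler_pdivrMr// mul1r.
    by apply: cmax; exact/eqP.
  rewrite -/(D0 j) -/(D0 i3) [X in _ = _ *: X]D3 scalerA mulrA divfK ?gt_eqF//.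
  by case: (h0 _ hj).
exists (q i0), (q i3); split; first by rewrite /endpoints convex_hull2E.
have [e3 f3] := ht _ (inD i3 i0) p3.
move=> y; rewrite -(span_basis Hef) span_cons span_seq1.
move=> /memv_addP[_ /vlineP[k ->] [_ /vlineP[l ->] ->]].
by rewrite dotvDr !dotvZr !(dotvC (q i3 - q i0)) e3 f3 !mulr0 addr0.
Qed.

End exposed_vertex.

(** * Borel sets and volumes in the space of row vectors *)

Section rV_borel.
Variables (R : realType) (n : nat).

Lemma measurable_box (A : 'I_n -> set R) : (forall i, measurable (A i)) ->
  measurable [set x : 'rV[R]_n | forall i, A i (x 0 i)].
Proof.
move=> mA; rewrite (_ : mkset _ = \bigcap_(i in [set: 'I_n])
  (fun x : 'rV[R]_n => x 0 i) @^-1` A i).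
  apply: fin_bigcap_measurable => // i _.
  by rewrite -[X in measurable X]setTI; exact: measurable_coord.
by apply/seteqP; split=> x /= Ax i; [move=> _; exact: Ax|exact: Ax].
Qed.

Definition rat_box (c : 'rV[rat]_n * nat) : set 'rV[R]_n :=
  [set x | forall i, `](ratr (c.1 0 i) - c.2.+1%:R^-1),
                       (ratr (c.1 0 i) + c.2.+1%:R^-1)[%classic (x 0 i)].

(** An open set is the union of the countably many boxes with rational centre and
    radius 1 / k.+1 that it contains. *)
Lemma rV_open_measurable (U : set 'rV[R]_n) : open U -> measurable U.
Proof.
move=> oU.
have -> : U = \bigcup_c (if `[< rat_box c `<=` U >] then rat_box c else set0).
  apply/seteqP; split => [x Ux|x [c _]]; last by case: asboolP => // + cx; apply.
  have /nbhs_ballP[r /= r0 xr] : nbhs x U by move: oU; rewrite openE; apply.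
  pose k := Num.truncn (2 / r); pose ek : R := k.+1%:R^-1.
  have ek0 : 0 < ek by rewrite invr_gt0 ltr0n.
  have ekr : ek *+ 2 < r.
    rewrite -mulr_natl /ek ltr_pdivrMr ?ltr0n// mulrC -ltr_pdivrMr//.
    exact: truncnS_gt.
  have approx i : exists y : rat, ratr y \in `](x 0 i - ek), (x 0 i + ek)[.
    by apply: rat_in_itvoo; lra.
  have [y yP] := choice approx.
  exists (\row_i y i, k) => //.
  have -> : `[< rat_box (\row_i y i, k) `<=` U >].
    apply/asboolP => z zb; suff zx : ball x r z by exact: xr.
      split=> // i j.
    rewrite ord1; have := zb j; have := yP j; rewrite /= !in_itv/= mxE -/ek.
    move=> /andP[y1 y2] /andP[z1 z2]; rewrite /ball/= ltr_norml.
    by apply/andP; split; lra.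
  move=> i; have := yP i; rewrite /= !in_itv/= mxE -/ek => /andP[y1 y2].
  by apply/andP; split; lra.
apply: countable_bigcupT_measurable => // c.
case: asboolP => // _; exact: (measurable_box (fun i => measurable_itv
  `](ratr (c.1 0 i) - c.2.+1%:R^-1 : R), (ratr (c.1 0 i) + c.2.+1%:R^-1)[)).
Qed.

Lemma rV_closed_measurable (F : set 'rV[R]_n) : closed F -> measurable F.
Proof.
move=> cF; rewrite -[F]setCK; apply: measurableC; apply: rV_open_measurable.
exact: closed_openC.
Qed.

Lemma lebesgue_rV_interior_gt0 (P : set 'rV[R]_n) : measurable P ->
  P° !=set0 -> (0 < lebesgue_rV P)%E.
Proof.
move=> mP [x /nbhs_ballP[r /= r0 xr]].
pose A i := `](x 0 i - r), (x 0 i + r)[%classic.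
have mB := measurable_box (fun i => measurable_itv `](x 0 i - r), (x 0 i + r)[).
apply: (@lt_le_trans _ _ (lebesgue_rV [set y : 'rV[R]_n | forall i, A i (y 0 i)])).
  rewrite lebesgue_rV_box; last by move=> i; exact: measurable_itv.
  rewrite (eq_bigr (fun=> (r *+ 2)%:E)).
    by rewrite prodEFin lte_fin prodr_gt0// => i _; rewrite pmulrn_lgt0.
  move=> i _; rewrite lebesgue_measure_itv/= lte_fin ifT; last by lra.
  by rewrite -EFinB; congr EFin; lra.
apply: le_measure; rewrite ?inE//.
move=> y Ay; suff yx : ball x r y by exact: xr.
split=> // i j; rewrite ord1; have := Ay j.
rewrite /A/= in_itv/= => /andP[y1 y2]; rewrite /ball/= ltr_norml.
by apply/andP; split; lra.
Qed.

Lemma lebesgue_rV_bounded_lty (P : set 'rV[R]_n) (M : R) : measurable P ->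
  (forall x, P x -> forall i, `|x 0 i| <= M) -> (lebesgue_rV P < +oo)%E.
Proof.
move=> mP PM; have mB := measurable_box (fun=> measurable_itv `[- M, M]).
apply: (@le_lt_trans _ _
  (lebesgue_rV [set y : 'rV[R]_n | forall i, `[- M, M]%classic (y 0 i)])).
  apply: le_measure; rewrite ?inE//.
  by move=> x Px i; rewrite /= in_itv/= -ler_norml; exact: PM.
rewrite (@lebesgue_rV_box R n (fun=> `[- M, M]%classic))//.
rewrite (eq_bigr (fun=> (fine (lebesgue_measure `[- M, M]%classic))%:E)).
  by rewrite prodEFin ltry.
move=> i _; rewrite fineK// lebesgue_measure_itv/=; case: ifP => //.
Qed.

End rV_borel.

Lemma continuous_bigsum (R : realType) (T : topologicalType)
    (V : normedModType R) (I : Type) (s : seq I) (F : I -> T -> V) :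
  (forall i, continuous (F i)) -> continuous (fun x => \sum_(i <- s) F i x).
Proof.
move=> cF; elim: s => [|i s IHs].
  by under eq_fun do rewrite big_nil; exact: cst_continuous.
by under eq_fun do rewrite big_cons; move=> x; apply: cvgD; [exact: cF|exact: IHs].
Qed.

Section hull_measurable.
Variables (R : realType) (d m : nat) (q : 'I_m -> 'rV[R]_d).

Lemma compact_hull : compact (convex_hull (range q)).
Proof.
pose S := [set l : 'rV[R]_m | (forall i, 0 <= l 0 i) /\ \sum_i l 0 i = 1].
have -> : convex_hull (range q) = [set \sum_i l 0 i *: q i | l in S].
  rewrite convex_hullE; apply/seteqP; split=> _ [l [l0 l1] <-].
    exists (\row_i l i).
      by split=> [i|]; rewrite ?mxE//; under eq_bigr do rewrite mxE.
    by apply: eq_bigr => i _; rewrite mxE.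
  by exists (fun i => l 0 i).
apply: continuous_compact.
  apply: continuous_subspaceT; apply: continuous_bigsum => i l.
  by apply: (@cvgZr_tmp _ _ _ (nbhs l)); exact: coord_continuous.
apply: (@subclosed_compact _ S [set l : 'rV[R]_m | forall i, `[0, 1]%classic (l 0 i)]).
- rewrite (_ : S = (\bigcap_(i in [set: 'I_m]) (fun l : 'rV[R]_m => l 0 i) @^-1` [set x | 0 <= x]) `&`
    (fun l : 'rV[R]_m => \sum_i l 0 i) @^-1` [set 1]); last first.
    apply/seteqP; split=> l [l0 l1]; split=> // i; [move=> _; exact: l0|exact: l0].
  apply: closedI.
    apply: closed_bigI => i _; apply: preimage_closed.
      by move=> l _; exact: coord_continuous.
    exact: closed_ge.
  apply: preimage_closed; last exact: closed_eq.
  move=> l _; apply: (@continuous_bigsum _ _ R^o) => i.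
  exact: coord_continuous.
- exact: (rV_compact (fun i => @segment_compact R 0 1)).
- move=> l [l0 l1] i; rewrite /= in_itv/= l0/= -l1 (bigD1 i)//= lerDl.
  exact: sumr_ge0.
Qed.

Lemma measurable_hull : measurable (convex_hull (range q)).
Proof.
apply: rV_closed_measurable; apply: compact_closed; first exact: norm_hausdorff.
exact: compact_hull.
Qed.

End hull_measurable.

(** * The cone at an exposed vertex *)

Section vertex_cone.
Variables (R : realType) (d m : nat) (q : 'I_m -> 'rV[R]_d) (i0 : 'I_m).
Variables (p p' : 'rV[R]_d).
Let P := convex_hull (range q).
Let V := q i0.
Hypothesis exposed : forall i, q i = V \/ 0 < dotv p (q i - V).
Local Notation dil s := (rV_homothety s ((1 - s) *: V)).

Definition plane_coord (x : 'rV[R]_d) : R[i] := dotv p x +i* dotv p' x.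

Let zeta x := plane_coord (x - V).

(** The countable union makes measurability immediate; [vertex_coneP] gives the
    usual description. *)
Definition vertex_cone : set 'rV[R]_d :=
  \bigcup_k (dil (k.+1%:R^-1) @^-1` P).

Lemma plane_coord_sum (I : Type) (s : seq I) (l : I -> R) (F : I -> 'rV[R]_d) :
  plane_coord (\sum_(i <- s) l i *: F i) =
  \sum_(i <- s) (l i)%:C * plane_coord (F i).
Proof.
elim: s => [|i s IHs]; first by rewrite !big_nil /plane_coord !dotv0r.
rewrite !big_cons -IHs /plane_coord !dotvDr !dotvZr.
by simpc.
Qed.

Lemma measurable_dotv (c : 'rV[R]_d) : measurable_fun setT (dotv c).
Proof.
apply: measurable_sum => i; apply: measurable_funM; first exact: measurable_cst.
exact: measurable_coord.
Qed.

Lemma cmeasurable_plane_coord : cmeasurable setT plane_coord.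
Proof. by split; exact: measurable_dotv. Qed.

Lemma vertex_dilB s x : dil s x - V = s *: (x - V).
Proof. by apply/rowP => i; rewrite !mxE; ring. Qed.

Lemma zeta_dil s x : zeta (dil s x) = s%:C * zeta x.
Proof. by rewrite /zeta vertex_dilB /plane_coord !dotvZr; simpc. Qed.

Lemma dil_dil s t x : dil s (dil t x) = dil (s * t) x.
Proof. by apply/rowP => i; rewrite !mxE; ring. Qed.

Lemma dil1 x : dil 1 x = x.
Proof. by apply/rowP => i; rewrite !mxE; ring. Qed.

Lemma hull_star s x : 0 <= s -> s <= 1 -> P x -> P (dil s x).
Proof.
move=> s0 s1 Px; have cP : @convex_set R (convex_lmodType 'rV[R]_d) P.
  by rewrite /P convex_hullE; exact: convex_set_combinations.
have -> : dil s x = s *: x + (1 - s) *: V by [].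
by apply: convex_combination => //; exact: hull_vertex.
Qed.

Lemma vertex_coneP x : vertex_cone x <-> exists2 s, 0 < s & P (dil s x).
Proof.
split=> [[k _ Pk]|[s s0 Ps]]; first by exists k.+1%:R^-1; rewrite ?invr_gt0.
exists (Num.truncn s^-1) => //=.
have ks : (Num.truncn s^-1).+1%:R^-1 <= s.
  rewrite -[leRHS]invrK lef_pV2 ?posrE ?invr_gt0//; exact/ltW/truncnS_gt.
set r := _%:R^-1 in ks *; have rs : r = r / s * s by rewrite divfK// lt0r_neq0.
rewrite /= rs -dil_dil; apply: hull_star => //; last by rewrite ler_pdivrMr// mul1r.
by rewrite divr_ge0 ?(ltW s0)// invr_ge0.
Qed.

Lemma hull_sub_vertex_cone : P `<=` vertex_cone.
Proof. by move=> x Px; apply/vertex_coneP; exists 1; rewrite ?dil1. Qed.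

Lemma vertex_cone_dil s : 0 < s -> dil s @^-1` vertex_cone = vertex_cone.
Proof.
move=> s0; apply/seteqP; split=> x /vertex_coneP[r r0 Pr]; apply/vertex_coneP.
  by exists (r * s); rewrite ?mulr_gt0// -dil_dil.
by exists (r / s); rewrite ?divr_gt0// dil_dil divfK ?gt_eqF.
Qed.

Lemma measurable_vertex_cone : measurable vertex_cone.
Proof.
apply: bigcupT_measurable => k; rewrite -[X in measurable X]setTI.
by apply: measurable_rV_homothety => //; exact: measurable_hull.
Qed.

Lemma hull_dotv_bound (c : 'rV[R]_d) x : P x ->
  `|dotv c x| <= \sum_i `|dotv c (q i)|.
Proof.
rewrite /P convex_hullE => -[l [l0 l1] <-]; rewrite dotv_combination.
apply: le_trans (ler_norm_sum _ _ _) _; apply: ler_sum => i _.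
rewrite normrM ger0_norm// ler_piMl//.
by rewrite -l1 (bigD1 i)//= lerDl sumr_ge0.
Qed.

Lemma zeta_combination l : weights l ->
  zeta (combination q l) = \sum_i (l i)%:C * zeta (q i).
Proof. by move=> wl; rewrite /zeta combinationB// plane_coord_sum. Qed.

(** Each generator lies in some sector |zeta| <= C Re zeta, and sectors are
    convex. *)
Lemma hull_zeta_sector : exists2 C, 0 < C &
  forall x, P x -> normc (zeta x) <= C * complex.Re (zeta x).
Proof.
pose C := 1 + \sum_i normc (zeta (q i)) / `|dotv p (q i - V)|.
have C0 : 0 < C.
  by rewrite ltr_pwDl// sumr_ge0// => i _; rewrite divr_ge0// normc_ge0.
exists C => // x; rewrite /P convex_hullE => -[l wl <-].
rewrite zeta_combination//; have [l0 _] := wl.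
apply: le_trans (normc_sum _ _ _) _.
have -> : complex.Re (\sum_i (l i)%:C * zeta (q i)) =
    \sum_i l i * complex.Re (zeta (q i)).
  rewrite (big_morph (@complex.Re R) (@complexReD R) (erefl : complex.Re 0 = 0)).
  by apply: eq_bigr => i _; rewrite complexReM/= mul0r subr0.
rewrite mulr_sumr; apply: ler_sum => i _.
rewrite ComplexField.Normc.normcM normc_real ger0_norm// mulrCA ler_wpM2l//.
have [qi|pi] := exposed i.
  by rewrite /zeta qi subrr /plane_coord !dotv0r/= mulr0 expr0n/= addr0 sqrtr0.
rewrite /= -ler_pdivrMr// /C (bigD1 i)//= addrCA -[X in X <= _]addr0.
rewrite gtr0_norm//; apply: lerD => //.
by rewrite addr_ge0// sumr_ge0.
Qed.

Lemma vertex_cone_sector C : (forall x, P x ->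
    normc (zeta x) <= C * complex.Re (zeta x)) ->
  forall x, vertex_cone x -> normc (zeta x) <= C * complex.Re (zeta x).
Proof.
move=> hC x /vertex_coneP[s s0 /hC]; rewrite zeta_dil.
rewrite ComplexField.Normc.normcM normc_real gtr0_norm// complexReM/=.
by rewrite mul0r subr0 mulrCA ler_pM2l.
Qed.

(** Close to the exposed vertex the cone does not leave P: the generators other
    than V are at height at least delta, so that a point of the cone of height at
    most delta has total weight at most 1 on them. *)
Lemma vertex_cone_trunc : exists2 delta, 0 < delta &
  forall x, vertex_cone x -> complex.Re (zeta x) <= delta -> P x.
Proof.
pose D := 1 + \sum_i `|dotv p (q i - V)|^-1.
have D0 : 0 < D by rewrite ltr_pwDl// sumr_ge0// => i _; rewrite invr_ge0.
exists D^-1; rewrite ?invr_gt0// => x /vertex_coneP[s s0].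
rewrite {1}/P convex_hullE => -[l wl xl] xD; have [l0 l1] := wl.
have xE : x - V = \sum_i (l i / s) *: (q i - V).
  have : s *: (x - V) = \sum_i l i *: (q i - V).
    by rewrite -vertex_dilB -xl combinationB.
  move=> /(congr1 (fun w => s^-1 *: w)); rewrite scalerA mulVf ?gt_eqF// scale1r.
  by move=> ->; rewrite scaler_sumr; apply: eq_bigr => i _; rewrite scalerA mulrC.
pose k i := if q i == V then 0 else l i / s.
have k0 i : 0 <= k i by rewrite /k; case: ifP => // _; rewrite divr_ge0// ltW.
have xk : x - V = \sum_i k i *: (q i - V).
  rewrite xE; apply: eq_bigr => i _; rewrite /k; case: eqP => // ->.
  by rewrite subrr !scaler0.
have k1 : \sum_i k i <= 1.
  have : complex.Re (zeta x) = \sum_i k i * dotv p (q i - V).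
    by rewrite /zeta xk /= dotv_sumr; apply: eq_bigr => i _; rewrite dotvZr.
  move=> ak; have : D^-1 * \sum_i k i <= D^-1.
    apply: le_trans xD; rewrite ak mulr_sumr; apply: ler_sum => i _.
    rewrite mulrC; have [qi|pi] := exposed i.
      by rewrite /k qi eqxx !mul0r.
    apply: ler_wpM2l => //.
    have Di : (dotv p (q i - V))^-1 <= D.
      by rewrite /D (bigD1 i)//= gtr0_norm// addrCA lerDl addr_ge0// sumr_ge0.
    by rewrite -[leRHS]invrK lef_pV2 ?posrE ?invr_gt0.
  by rewrite -[leRHS]mulr1 ler_pM2l ?invr_gt0.
rewrite /P convex_hullE.
pose k' i := k i + (i0 == i)%:R * (1 - \sum_j k j).
have wk' : weights k'.
  split=> [i|]; first by rewrite addr_ge0// mulr_ge0// subr_ge0.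
  rewrite big_split/= -mulr_suml; have [_ ->] := @weights_vertex R m i0.
  by rewrite mul1r addrC subrK.
exists k' => //; apply: (addIr (- V)); rewrite combinationB// xk /k'.
under eq_bigr do rewrite scalerDl; rewrite big_split/= -[RHS]addr0.
congr (_ + _); apply: big1 => i _.
by have [<-|_] := eqVneq i0 i; rewrite ?subrr ?scaler0// mul0r scale0r.
Qed.

Lemma hull_finite_volume : (lebesgue_rV P < +oo)%E.
Proof.
apply: (@lebesgue_rV_bounded_lty _ _ _
  (\sum_i \sum_j `|dotv (delta_mx 0 i) (q j)|)); first exact: measurable_hull.
move=> x Px i; have -> : x 0 i = dotv (delta_mx 0 i) x.
  rewrite /dotv (bigD1 i)//= mxE !eqxx mul1r big1 ?addr0// => j ji.
  by rewrite mxE eqxx (negPf ji) mul0r.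
apply: le_trans (hull_dotv_bound _ Px) _.
by rewrite (bigD1 i)//= lerDl sumr_ge0// => j _; rewrite sumr_ge0.
Qed.

End vertex_cone.

Section assembly.
Variables (R : realType) (d : nat).

(** On the unit circle 1 / w = conj w, and w conj (zeta) + conj w zeta is twice
    cos t <x, e> + sin t <x, f>. *)
Lemma fourier_laplace_circle (P : set 'rV[R]_d) (alpha : R[i]) (e f : 'rV[R]_d)
    (t : R) :
  fourier_laplace P
    ((alpha * (cos t)%:C) *: toC e + (alpha * (sin t)%:C) *: toC f) =
  cint (@lebesgue_rV R d) P (fun x =>
    cexp ((cos t +i* sin t) * ((0 -i* pi) * alpha * conjc (plane_coord e f x)) +
      (cos t +i* sin t)^-1 * ((0 -i* pi) * alpha * plane_coord e f x))).
Proof.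
apply: eq_cint => x _; congr cexp.
rewrite dotvDr !dotvZr.
have toCE y : dotv (toC x) (toC y) = (dotv y x)%:C.
  rewrite /dotv rmorph_sum/=; apply: eq_bigr => i _.
  by rewrite !mxE rmorphM mulrC.
rewrite !toCE /plane_coord.
have -> : (cos t +i* sin t)^-1 = cos t -i* sin t.
  have c0 : cos t +i* sin t != 0 by rewrite -normc_eq0 normc_cis oner_eq0.
  apply: (mulfI c0); rewrite divff//; simpc; rewrite [sin t * cos t]mulrC addNr.
  by rewrite -!expr2 cos2Dsin2.
case: alpha => a1 a2; move: (dotv e x) (dotv f x) => X Y; simpc.
by congr (_ +i* _); ring.
Qed.

(** The coordinates along (e, f) and along (e + t f, f - t e) differ by the factor
    1 - i t. Choosing w = - s (1 + i t) / A turns the first term of the phase into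
    - s conj (zeta) up to its value at the vertex, which factors out of the
    integral. *)
Lemma exposed_vertex_transform (m : nat) (q : 'I_m -> 'rV[R]_d) (i0 : 'I_m)
    (alpha : R[i]) (e f : 'rV[R]_d) (t s : R) (P := convex_hull (range q))
    (zeta := fun x => plane_coord (e + t *: f) (f - t *: e) (x - q i0)) :
  alpha != 0 -> 0 < s -> circle alpha e f `<=` transform_null_set P ->
  cint (@lebesgue_rV R d) P (fun x =>
    cexp (- (s%:C * conjc (zeta x)) -
      (((0 -i* pi) * alpha) ^+ 2 / (1 + t ^+ 2)%:C / s%:C) * zeta x)) = 0.
Proof.
move=> al0 s0 null.
set A := (0 -i* pi) * alpha.
have pi0 : (0 -i* pi : R[i]) != 0.
  by rewrite eq_complex/= negb_and oppr_eq0 (gt_eqF (pi_gt0 R)) orbT.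
have A0 : A != 0 by rewrite mulf_neq0.
pose z0 := plane_coord e f.
pose u x := A * conjc (z0 x); pose v x := A * z0 x.
have mP : measurable P by exact: measurable_hull.
have Pfin := hull_finite_volume q.
have mz : cmeasurable P z0.
  by have [z1 z2] := cmeasurable_plane_coord e f; split; exact: measurable_funTS.
have mu_ : cmeasurable P u.
  by apply: cmeasurableM; [exact: cmeasurable_cst|exact: cmeasurable_conj].
have mv_ : cmeasurable P v by apply: cmeasurableM => //; exact: cmeasurable_cst.
pose M := normc A * (\sum_i `|dotv e (q i)| + \sum_i `|dotv f (q i)|).
have M0 : 0 <= M by rewrite mulr_ge0 ?normc_ge0// addr_ge0// sumr_ge0.
have zM x : P x -> normc A * normc (z0 x) <= M.
  move=> Px; rewrite ler_wpM2l ?normc_ge0//; apply: le_trans (normc_le_ReIm _) _.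
  by apply: lerD; exact: hull_dotv_bound.
have uM x : P x -> normc (u x) <= M.
  move=> Px; rewrite ComplexField.Normc.normcM (_ : normc (conjc _) = normc (z0 x)).
    exact: zM.
  by rewrite /= sqrrN.
have vM x : P x -> normc (v x) <= M.
  by move=> Px; rewrite ComplexField.Normc.normcM; exact: zM.
have vanish := cint_laurent_vanish mP Pfin M0 mu_ mv_ uM vM.
have {}vanish w : w != 0 ->
    cint (@lebesgue_rV R d) P (fun x => cexp (w * u x + w^-1 * v x)) = 0.
  apply: vanish => z z1; have [r rpi ->] := cis_arg z1.
  rewrite -(@fourier_laplace_circle P alpha e f r); apply: null.
  by exists r.
pose mu : R[i] := 1 +i* t.
have mu0 : mu != 0 by rewrite eq_complex/= oner_eq0.
have s0c : s%:C != 0 :> R[i] by rewrite -normc_eq0 normc_real normr_eq0 gt_eqF.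
pose w := - (s%:C * mu) / A.
have w0 : w != 0 by rewrite mulf_neq0 ?invr_eq0// oppr_eq0 mulf_neq0.
pose c := cexp (w * u (q i0) + w^-1 * v (q i0)).
have c0 : c != 0 by rewrite -normc_eq0 normc_cexp gt_eqF// expR_gt0.
have cmu0 : conjc mu != 0 by rewrite conjc_eq0.
have zE x : z0 x = z0 (q i0) + zeta x / conjc mu.
  have <- : conjc mu * z0 (x - q i0) = zeta x.
    rewrite /z0 /zeta /plane_coord !(dotvDl, dotvNl, dotvZl) /=; simpc.
    by [].
  rewrite mulrC mulKf// /z0 /plane_coord !dotvBr.
  by simpc; congr (_ +i* _); ring.
have iE := cintegrable_exp_laurent mP Pfin mu_ mv_ uM vM w.
transitivity (c^-1 * cint (@lebesgue_rV R d) P (fun x => cexp (w * u x + w^-1 * v x)));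
  last by rewrite vanish// mulr0.
rewrite -cintZ//; apply: eq_cint => x Px.
apply: (mulfI c0); rewrite [RHS]mulVKf// /c -cexpD; congr cexp.
have uE : u x = A * (conjc (z0 (q i0)) + conjc (zeta x) / mu).
  by rewrite /u zE conjcD conjcM conjc_inv conjcK.
have n2 : (1 + t ^+ 2)%:C = mu * conjc mu :> R[i].
  by rewrite /mu; simpc; congr (_ +i* _); ring.
rewrite uE /v (zE x) /u n2 /w.
move: (conjc (zeta x)) (zeta x) (conjc (z0 (q i0))) (z0 (q i0)) => cz z cv zv.
move: cmu0; move: (conjc mu) => cm cm0; field.
by rewrite A0 mu0 cm0 s0c.
Qed.

End assembly.

Theorem theorem1p2 (R : realType) (d : nat) (P : set 'rV[R]_d)
    (H : {vspace 'rV[R]_d}) (e f : 'rV[R]_d) :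
  (2 <= d)%N ->
  polytope P ->
  full_dimensional P ->
  \dim H = 2%N ->
  (forall F, edge P F -> ~ orthogonal_to_edge H F) ->
  orthonormal_basis2 H e f ->
  forall alpha : R[i], alpha != 0 ->
  ~ (circle alpha e f `<=` transform_null_set P).
Proof.
move=> _ [S /finite_seqP[s ->] ->] fullP _ noedge [Hef _ _ _] alpha al0 null.
pose q (i : 'I_(size s)) := tnth (in_tuple s) i.
have sE : [set` s] = range q.
  apply/seteqP; split=> [x /= xs|_ [i _ <-]]; last exact: mem_tnth.
  have /tnthP[i ->] : x \in in_tuple s by [].
  by exists i.
move: fullP noedge null; rewrite sE => fullP noedge null.
have Ppos : (0 < lebesgue_rV (convex_hull (range q)))%E.
  by apply: lebesgue_rV_interior_gt0 => //; exact: measurable_hull.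
have [j0 _] : exists j0 : 'I_(size s), True.
  have [x Px] := fullP; have := interior_subset Px.
  rewrite convex_hullE => -[l [_ l1] _].
  case: (pickP 'I_(size s)) => [j _|nj]; first by exists j.
  by move: l1; rewrite big_pred0// => /eqP; rewrite eq_sym oner_eq0.
have [t [i0 exposed]] := exposed_vertex j0 Hef noedge.
have [C C0 sector] := hull_zeta_sector (f - t *: e) exposed.
have [delta delta0 trunc] := vertex_cone_trunc (f - t *: e) exposed.
pose zeta x := plane_coord (e + t *: f) (f - t *: e) (x - q i0).
have mzeta : cmeasurable setT zeta.
  have [z1 z2] := cmeasurable_plane_coord (e + t *: f) (f - t *: e).
  have mB : measurable_fun setT (fun x : 'rV[R]_d => x - q i0).
    apply/measurable_fun_rVP => i; under eq_fun do rewrite !mxE.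
    by apply: measurable_funB => //; exact: measurable_coord.
  by split; [exact: (measurableT_comp z1 mB)|exact: (measurableT_comp z2 mB)].
have PM x : convex_hull (range q) x -> complex.Re (zeta x) <=
    \sum_i `|dotv (e + t *: f) (q i)| - dotv (e + t *: f) (q i0).
  move=> Px; rewrite /= dotvBr lerD2r.
  exact: le_trans (ler_norm _) (hull_dotv_bound _ Px).
have B0 : ((0 -i* pi) * alpha) ^+ 2 / (1 + t ^+ 2)%:C != 0.
  rewrite mulf_neq0 ?expf_neq0 ?invr_eq0 ?mulf_neq0//.
    by rewrite eq_complex/= negb_and oppr_eq0 (gt_eqF (pi_gt0 R)) orbT.
  by rewrite -normc_eq0 normc_real normr_eq0 gt_eqF// ltr_pwDl// sqr_ge0.
apply: (@cone_transform_neq0 R d (convex_hull (range q)) (vertex_cone q i0)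
  (q i0) zeta C delta _ _ _ _ mzeta _ _ C0 delta0 _ trunc PM _ Ppos _ B0).
- exact: measurable_hull.
- exact: measurable_vertex_cone.
- exact: hull_sub_vertex_cone.
- by move=> s' x; exact: zeta_dil.
- by move=> s' s0; exact: vertex_cone_dil.
- exact: vertex_cone_sector.
- exact: hull_finite_volume.
by move=> s' s0; exact: exposed_vertex_transform.
Qed.
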